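(* Let $\Gamma$ be the LASSO support algorithm with the guarantees described in the context. There exist a universal constant $\bar c\ge1$ and positive universal constants $\mathbf{C}_1,\mathbf{C}_2$ with the following property. Let $v\in\mathbb{R}^N$, $S=\mathsf{supp}(v)$, $s=|S|$, and assume $\ln(N/2)\le s\le N/8$ and $m\le N/9$. Let $U\in\mathbb{R}^{m\times N}$ be random with i.i.d. standard Gaussian entries and $b=Uv$. Assume that (i) $m>(1+\epsilon)12s\ln(N-s)$ for some $\epsilon\in(0,1/2)$ with $\epsilon>8\sqrt{s/m}$, (ii) $\bar c\lambda<2m\min_{j\in S}|v_j|-\frac1{N^2}$, (iii) $\lambda\ge\frac2{N^2}$. Then, with probability at least $1-\mathbf{C}_1N^{-\mathbf{C}_2}$, the algorithm $\Gamma$, which reads variable-precision approximations of the input $(b,U)$, returns $S=\mathsf{supp}(v)$ with a cost bounded by $\mathcal{O}\big(N^3(\log_2(N[\![v]\!]_2))^2\big)$ and a maximum number of digits bounded by $\mathcal{O}\big(\lceil\log_2(N[\![v]\!]_2)\rceil\big)$.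
   Context: $[\![v]\!]_2:=\max\{1,\|v\|_2\}$. $\lambda>0$ is the (rational) LASSO parameter. LASSO. $\mathsf{Sol}^{\mathsf{UL}}(y,A)=\operatorname{argmin}_{\hat x\in\mathbb{R}^N}\|A\hat x-y\|_2^2+\lambda\|\hat x\|_1$ and $\Xi(y,A)=\{\mathsf{supp}(x):x\in\mathsf{Sol}^{\mathsf{UL}}(y,A)\}$ for $(y,A)\in\mathbb{R}^m\times\mathbb{R}^{m\times N}$. The stability support $\mathsf{stsp}(y,A)$ is the infimum of all $\delta\ge0$ for which there exist $\tilde y\in\mathbb{R}^m,\tilde A\in\mathbb{R}^{m\times N}$, $x\in\mathsf{Sol}^{\mathsf{UL}}(y,A)$, $\tilde x\in\mathsf{Sol}^{\mathsf{UL}}(\tilde y,\tilde A)$ with $\|\tilde y-y\|_\infty\le\delta$, $\|\tilde A-A\|_{\max}\le\delta$ and $\mathsf{supp}(x)\neq\mathsf{supp}(\tilde x)$, where $\|M\|_{\max}=\max_{i,j}|M_{ij}|$. $\mathscr{C}_{\mathrm{UL}}(y,A)=\mathsf{stsp}(y,A)^{-1}$ if $\mathsf{stsp}(y,A)\ne0$, else $\infty$. Algorithms. An algorithm reads variable-precision approximations of $(b,U)$: for any $n\in\mathbb{N}$ it may request (dyadic rational) approximations of all entries of $b$ and $U$ with entrywise error at most $2^{-n}$; operations on the numbers read are performed exactly. Its cost is the number of operations performed, and its maximum number of digits is the largest $n$ requested. The algorithm $\Gamma$ (known from a companion paper) has these guarantees: for every $(b,U)\in\mathbb{R}^m\times\mathbb{R}^{m\times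 N}$ (and every choice of approximations supplied to it), if $\mathscr{C}_{\mathrm{UL}}(b,U)<\infty$ then $\Gamma$ halts and returns an element of $\Xi(b,U)$, with cost $\mathcal{O}\{N^3[\log_2(N^2[\![(b,U)]\!]_{\max}^2\,\mathscr{C}_{\mathrm{UL}}(b,U))]^2\}$ and number of digits $\mathcal{O}(\lceil\log_2\max\{\lambda+\lambda^{-1},N,[\![(b,U)]\!]_{\mathrm S},\mathscr{C}_{\mathrm{UL}}(b,U)\}\rceil)$; if $\mathscr{C}_{\mathrm{UL}}(b,U)=\infty$ then $\Gamma$ runs forever. Here $[\![(b,U)]\!]_{\max}=\max\{\|b\|_\infty,\|U\|_{\max},1\}$ and $[\![(b,U)]\!]_{\mathrm S}=\max\{\sum_{i,j}|U_{ij}|,\sum_i|b_i|,1\}$. All constants implied by $\mathcal{O}(\cdot)$ are universal (those in the claim depending only on those in the guarantees of $\Gamma$). *)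

(* Defs.v *)
From HB Require Import structures.
From mathcomp Require Import all_boot all_order all_algebra.
From mathcomp Require Import all_classical all_reals all_analysis.

Set Implicit Arguments.
Unset Strict Implicit.
Unset Printing Implicit Defensive.

Import Order.TTheory GRing.Theory Num.Theory.
Import numFieldNormedType.Exports.

Local Open Scope classical_set_scope.
Local Open Scope ring_scope.

Section Norms.
Context {R : realType}.

Definition log2 (x : R) : R := ln x / ln 2.

Definition norm1 n (x : 'cV[R]_n) : R := \sum_i `|x i 0|.

Definition norm2 n (x : 'cV[R]_n) : R := Num.sqrt (\sum_i x i 0 ^+ 2).

Definition bnorm2 n (v : 'cV[R]_n) : R := Num.max 1 (norm2 v).

(* [mx_norm] is the maximum of the absolute values of the entries. *)
Definition bnorm_max m n (b : 'cV[R]_m) (U : 'M[R]_(m, n)) : R :=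
  Num.max (Num.max (mx_norm b) (mx_norm U)) 1.

Definition bnorm_sum m n (b : 'cV[R]_m) (U : 'M[R]_(m, n)) : R :=
  Num.max (Num.max (\sum_i \sum_j `|U i j|) (norm1 b)) 1.

Definition supp n (x : 'cV[R]_n) : {set 'I_n} := [set i | x i 0 != 0]%SET.

(* The infimum of a nonempty finite set of reals is its minimum; the junk value
   for v = 0 is 0. *)
Definition min_abs n (v : 'cV[R]_n) : R :=
  inf [set `|v j 0| | j in [set` supp v]].

End Norms.

Section Lasso.
Context {R : realType} (lam : R) (m n : nat).
Implicit Types (y : 'cV[R]_m) (A : 'M[R]_(m, n)) (x : 'cV[R]_n).

Definition lasso_obj y A x : R := norm2 (A *m x - y) ^+ 2 + lam * norm1 x.

Definition lasso_sol y A : set 'cV[R]_n :=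
  [set x | forall z, lasso_obj y A x <= lasso_obj y A z].

Definition lasso_supp y A : set {set 'I_n} := [set supp x | x in lasso_sol y A].

(* An extended real: +oo when the support never changes. *)
Definition stsp y A : \bar R :=
  ereal_inf [set delta%:E | delta in
    [set delta : R | 0 <= delta /\
      exists (y' : 'cV[R]_m) (A' : 'M[R]_(m, n)) (x x' : 'cV[R]_n),
        [/\ lasso_sol y A x, lasso_sol y' A' x',
            mx_norm (y' - y) <= delta, mx_norm (A' - A) <= delta &
            supp x <> supp x']]].

Definition condUL y A : \bar R :=
  if stsp y A == 0%E then +oo%E else (stsp y A)^-1%E.

End Lasso.

(* Algorithms are programs of a random-access machine with index registers
   (natural numbers) and number registers (rationals, with exact field
   operations and comparisons).  [Request a] asks for approximations of all the
   entries of the input with error at most 2^-n, where n is the content of index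
   register a; the entries obtained are then accessible one by one.  The output
   is the set of indices inserted during the run. *)
Inductive arith := Add | Sub | Mul | Div.

Inductive instr :=
  | IConst of nat & nat               (* I[d] := k *)
  | IOp of arith & nat & nat & nat    (* I[d] := I[a] op I[b] *)
  | IJumpLe of nat & nat & nat        (* if I[a] <= I[b] goto l *)
  | QConst of nat & rat               (* Q[d] := q *)
  | QOfI of nat & nat                 (* Q[d] := I[a] *)
  | QOp of arith & nat & nat & nat    (* Q[d] := Q[a] op Q[b] *)
  | QJumpLe of nat & nat & nat        (* if Q[a] <= Q[b] goto l *)
  | QLoad of nat & nat                (* Q[d] := Q[I[a]] *)
  | QStore of nat & nat               (* Q[I[a]] := Q[b] *)
  | Request of nat
  | ReadB of nat & nat                (* Q[d] := entry I[i] of b *)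
  | ReadU of nat & nat & nat          (* Q[d] := entry (I[i], I[j]) of U *)
  | Insert of nat                     (* insert I[a] into the output *)
  | Halt.

Definition program := seq instr.

Record state := State {
  pc : nat;
  ireg : nat -> nat;
  qreg : nat -> rat;
  prec : option nat;   (* precision of the last request *)
  digits : nat;        (* largest precision requested so far *)
  out : seq nat }.

Definition iarith (op : arith) : nat -> nat -> nat :=
  match op with Add => addn | Sub => subn | Mul => muln | Div => divn end.

Definition qarith (op : arith) (x y : rat) : rat :=
  match op with Add => x + y | Sub => x - y | Mul => x * y | Div => x / y end.

Definition upd (T : Type) (f : nat -> T) (d : nat) (x : T) : nat -> T :=
  fun k => if k == d then x else f k.

(* The approximations of (b, U) supplied at each precision. *)
Definition oracle (m n : nat) := nat -> 'cV[rat]_m * 'M[rat]_(m, n).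

Section Execution.
Context (m n : nat) (o : oracle m n).

Definition readB (p : option nat) (i : nat) : rat :=
  match p, insub i with
  | Some k, Some i' => (o k).1 i' 0
  | _, _ => 0
  end.

Definition readU (p : option nat) (i j : nat) : rat :=
  match p, insub i, insub j with
  | Some k, Some i', Some j' => (o k).2 i' j'
  | _, _, _ => 0
  end.

Definition next (s : state) : state :=
  State (pc s).+1 (ireg s) (qreg s) (prec s) (digits s) (out s).

Definition goto (l : nat) (s : state) : state :=
  State l (ireg s) (qreg s) (prec s) (digits s) (out s).

Definition setireg (d k : nat) (s : state) : state :=
  State (pc s) (upd (ireg s) d k) (qreg s) (prec s) (digits s) (out s).

Definition setqreg (d : nat) (q : rat) (s : state) : state :=
  State (pc s) (ireg s) (upd (qreg s) d q) (prec s) (digits s) (out s).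

Definition request (k : nat) (s : state) : state :=
  State (pc s) (ireg s) (qreg s) (Some k) (maxn (digits s) k) (out s).

Definition insert (k : nat) (s : state) : state :=
  State (pc s) (ireg s) (qreg s) (prec s) (digits s) (k :: out s).

Definition exec (c : instr) (s : state) : state :=
  let I := ireg s in
  let Q := qreg s in
  match c with
  | IConst d k => next (setireg d k s)
  | IOp op d a b => next (setireg d (iarith op (I a) (I b)) s)
  | IJumpLe a b l => if (I a <= I b)%N then goto l s else next s
  | QConst d q => next (setqreg d q s)
  | QOfI d a => next (setqreg d (I a)%:R s)
  | QOp op d a b => next (setqreg d (qarith op (Q a) (Q b)) s)
  | QJumpLe a b l => if Q a <= Q b then goto l s else next s
  | QLoad d a => next (setqreg d (Q (I a)) s)
  | QStore a b => next (setqreg (I a) (Q b) s)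
  | Request a => next (request (I a) s)
  | ReadB d i => next (setqreg d (readB (prec s) (I i)) s)
  | ReadU d i j => next (setqreg d (readU (prec s) (I i) (I j)) s)
  | Insert a => next (insert (I a) s)
  | Halt => s
  end.

Definition halted (G : program) (s : state) : bool :=
  if nth Halt G (pc s) is Halt then true else false.

(* The machine starts with the dimensions in I[0], I[1] and lambda in Q[0]. *)
Definition init (lam : rat) : state :=
  State 0 (fun k => nth 0%N [:: m; n] k) (fun k => nth 0 [:: lam] k) None 0 [::].

Definition run (G : program) (lam : rat) (c : nat) : state :=
  iter c (fun s => exec (nth Halt G (pc s)) s) (init lam).

(* G halts after exactly c operations with output S, the largest precision
   requested being k. *)
Definition computes (G : program) (lam : rat) (S : {set 'I_n}) (c k : nat) : Prop :=
  [/\ halted G (run G lam c),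
      forall c', (c' < c)%N -> ~~ halted G (run G lam c'),
      S = [set j : 'I_n | (j : nat) \in out (run G lam c)]%SET &
      k = digits (run G lam c)].

End Execution.

Definition dyadic (q : rat) : Prop :=
  exists (z : int) (k : nat), q = z%:~R / 2 ^+ k.

Definition approximates (R : realType) m n (o : oracle m n)
    (b : 'cV[R]_m) (U : 'M[R]_(m, n)) : Prop :=
  forall k : nat,
    [/\ forall i, dyadic ((o k).1 i 0),
        forall i j, dyadic ((o k).2 i j),
        forall i, `|ratr ((o k).1 i 0) - b i 0| <= 2 ^- k &
        forall i j, `|ratr ((o k).2 i j) - U i j| <= 2 ^- k].

(* The bound K * N^3 * (log2 ...)^2 of an asymptotic estimate vanishes where the
   argument of the logarithm is 1 (which does occur, for large lambda), so the
   logarithm is bounded below by 1 in the hypothesis on the cost. *)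
Definition lasso_guarantees (R : realType) (K1 K2 : R) (lam : rat) (m n : nat)
    (G : program) : Prop :=
  forall (b : 'cV[R]_m) (U : 'M[R]_(m, n)) (o : oracle m n),
    approximates o b U ->
    let C := condUL (ratr lam) b U in
    ((C < +oo)%E ->
      exists (S : {set 'I_n}) (c k : nat),
        [/\ computes o G lam S c k,
            lasso_supp (ratr lam) b U S,
            c%:R <= K1 * (n%:R ^+ 3 *
              Num.max 1 (log2 (n%:R ^+ 2 * bnorm_max b U ^+ 2 * fine C)) ^+ 2) &
            k%:R <= K2 * (Num.ceil (log2
              (Num.max (Num.max (ratr lam + (ratr lam)^-1) n%:R)
                       (Num.max (bnorm_sum b U) (fine C)))))%:~R])
    /\ (C = +oo%E -> forall c, ~~ halted G (run o G lam c)).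

Section Gaussian.
Context d (T : measurableType d) (R : realType) (P : probability T R).

Definition mutually_independent (I : finType) (X : I -> {RV P >-> R}) : Prop :=
  forall (J : {set I}) (B : I -> set R), (forall i, measurable (B i)) ->
    P (\bigcap_(i in [set` J]) (X i @^-1` B i)) =
    (\prod_(i in J) P (X i @^-1` B i))%E.

Definition iid_std_gaussian (I : finType) (X : I -> {RV P >-> R}) : Prop :=
  mutually_independent X /\
  forall i (B : set R), measurable B ->
    distribution P (X i) B = normal_prob 0 1 B.

Definition random_mx m n (X : 'I_m * 'I_n -> {RV P >-> R}) (w : T) : 'M[R]_(m, n) :=
  \matrix_(i, j) X (i, j) w.

End Gaussian.

(* Main.v *)
Require Import Defs.
From HB Require Import structures.
From mathcomp Require Import all_boot all_order all_algebra.
From mathcomp Require Import all_classical all_reals all_analysis.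
From mathcomp Require Import measurable_realfun measurable_fun_approximation.
From mathcomp Require Import ring lra.

(** The support of the LASSO solution is certified by the vector
[u = (A_S^T A_S)^-1 e], where [e] is the sign vector of [v]: the point
[v - (lam/2) u] satisfies the optimality conditions as soon as its signs are
those of [v] and [|a_j . A u| < 1] for every column [a_j] outside [S].  A margin
in both conditions survives any perturbation of size [1/poly(N, |v|)] of the
data, which bounds the condition number, hence the cost.

The margins follow from two facts about the Gaussian matrix: (1) [A] satisfies
[m/4 |x|^2 <= |A x|^2] for [x] supported in [S]; (2) for every [j], inside or
outside [S], [|a_j . A w_j| <= 9/10], where [w_j] is the vector [u] built on
[S \ {j}].  For [j] outside [S], (2) is the dual condition itself.  For [j] in [S],
[u - w_j] is orthogonal for the Gram matrix to every coordinate vector of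
[S \ {j}], so (1) and (2) bound the [j]-th coordinate of [u] by [8/m], which
controls the signs.  Fact (1) is a lower tail bound for [chi^2_m] on a grid with at
most [N^s] points, and (2) is a Gaussian tail bound, the column [a_j] being
independent of [A w_j]. *)

Set Implicit Arguments.
Unset Strict Implicit.
Unset Printing Implicit Defensive.

Import Order.TTheory GRing.Theory Num.Theory.
Import numFieldNormedType.Exports.

Local Open Scope classical_set_scope.
Local Open Scope ring_scope.

(** * Independent Gaussian families *)

(** Hypothesis (i) pays for the union bounds. For N >= 10^5 it yields m >= 11 s ln N, and 11 is
    enough both for the grid (N^s points against e^(-m/6)) and for the N columns, each failing with
    probability at most 2 N^(-11/10). Smaller N are absorbed by the constant in front of the
    probability. The obstacle inside S is a sup norm: the signs of v - (lam/2) u require |u_j| =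
    O(1/m) for every j, while (1) alone gives the Euclidean bound |u| <= 4 sqrt(s)/m. Leaving out
    one column gains the factor sqrt(s), and the same tail bound then serves inside and outside S.
    The weights A w_j in that tail bound are random, and their norm is controlled only where (1)
    holds. Hence the variables are integrated out one at a time, the weights being frozen, and the
    norm constraint is made part of the event. In the grid argument, the bound ln N on the entries
    of A replaces a bound on its operator norm. *)

Section IntegralIndependent.
Context d1 d2 d3 (T : measurableType d1) (T1 : measurableType d2)
  (T2 : measurableType d3) (R : realType) (P : probability T R).
Context (Y : {mfun T >-> T1}) (W : {mfun T >-> T2}).
Hypothesis YW : forall A B, measurable A -> measurable B ->
  (P (Y @^-1` A `&` W @^-1` B) = P (Y @^-1` A) * P (W @^-1` B))%E.

(** By uniqueness of product measures, factorization on rectangles identifies the joint law; Tonelli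
    does the rest. The target of [W] is arbitrary so that [W] can be the identity of [T] onto a
    coarser sigma-algebra. *)
Lemma integral_independent (f : T1 * T2 -> \bar R) :
  measurable_fun [set: T1 * T2] f -> (forall x, (0 <= f x)%E) ->
  (\int[P]_w f (Y w, W w) = \int[P]_w \int[distribution P Y]_x f (x, W w))%E.
Proof.
move=> mf f0.
have mph : measurable_fun setT (fun w : T => (Y w, W w)).
  exact: measurable_fun_pair.
pose ph : {mfun T >-> (T1 * T2)%type} := HB.pack (fun w : T => (Y w, W w))
  (isMeasurableFun.Build _ _ _ _ _ mph).
have mE A : measurable A ->
    (distribution P Y \x distribution P W)%E A = distribution P ph A.
  by move=> mA; apply: product_measure_unique => // B C mB mC; rewrite -YW.
have -> : (\int[P]_w f (Y w, W w) = \int[distribution P ph]_z f z)%E.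
  by rewrite ge0_integral_pushforward.
rewrite (eq_measure_integral (distribution P Y \x distribution P W)%E); last first.
  by move=> A mA _; apply/esym/mE.
rewrite fubini_tonelli2 // ge0_integral_pushforward//.
  exact: measurable_fun_fubini_tonelli_G.
by move=> y _; exact: integral_ge0.
Qed.

End IntegralIndependent.

Section IndependentFamilies.
Context d (T : measurableType d) (R : realType) (P : probability T R).
Context (I : finType) (X : I -> {RV P >-> R}).
Implicit Types (J K : {set I}) (k : I).

(** The pi-system generating the sigma-algebra of the [X i], [i] in [J]. Below, [sigmaT J] is [T]
    carrying that sigma-algebra, so that dependence on these variables alone is expressed as
    measurability on [sigmaT J]. *)
Definition rect_sets J : set (set T) :=
  [set A | exists B : I -> set R, (forall i, measurable (B i)) /\
     A = \bigcap_(i in [set` J]) (X i @^-1` B i)].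

Notation sigmaT J := (g_sigma_algebraType (rect_sets J)).

Lemma rect_sets_measurable J : rect_sets J `<=` measurable.
Proof.
move=> _ [B [mB ->]]; apply: fin_bigcap_measurable => // i _.
by rewrite -[X in measurable X]setTI; exact: measurable_funPT.
Qed.

Lemma rect_setsI J : setI_closed (rect_sets J).
Proof.
move=> _ _ [B [mB ->]] [B' [mB' ->]]; exists (fun i => B i `&` B' i); split.
  by move=> i; exact: measurableI.
by rewrite -bigcapI; apply: eq_bigcapr => i _.
Qed.

Lemma rect_setsT J : rect_sets J setT.
Proof.
exists (fun=> setT); split => //; rewrite bigcapT//.
Qed.

Hypothesis indep : mutually_independent X.

(** Both sides are finite measures in [A]. They agree on the pi-system [rect_sets J], by [indep] for
    [k |: J], hence on the sigma-algebra it generates. *)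
Lemma indep_sigma k J (B : set R) (A : set T) : k \notin J -> measurable B ->
  <<s rect_sets J >> A ->
  (P (X k @^-1` B `&` A) = P (X k @^-1` B) * P A)%E.
Proof.
move=> kJ mB.
have mXB : measurable (X k @^-1` B).
  by rewrite -[X in measurable X]setTI; exact: measurable_funPT.
have PB : (P (X k @^-1` B) = (fine (P (X k @^-1` B)))%:E)%E.
  by rewrite fineK// fin_num_measure.
have PB0 : 0 <= fine (P (X k @^-1` B)) by exact: fine_ge0.
pose c : {nonneg R} := NngNum PB0.
move=> sA; rewrite setIC.
rewrite [RHS](_ : _ = mscale c P A); last by rewrite /mscale/= -PB.
apply: (@g_sigma_algebra_measure_unique _ R T (rect_sets J) _ (fun=> setT) _ _
  (mrestr P mXB) (mscale c P)) => //.
- exact: rect_sets_measurable.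
- by move=> _; exact: rect_setsT.
- by rewrite bigcup_const.
- exact: rect_setsI.
- move=> _ [B' [mB' ->]]; rewrite /mrestr/= /mscale/= -PB.
  pose B2 i := if i == k then B else B' i.
  have mB2 i : measurable (B2 i) by rewrite /B2; case: ifP.
  have := indep (k |: J)%SET mB2.
  rewrite big_setU1//= {2}/B2 eqxx.
  have -> : (\prod_(i in J) P (X i @^-1` B2 i) = P (\bigcap_(i in [set` J]) (X i @^-1` B' i)))%E.
    rewrite (indep J mB'); apply: eq_bigr => i iJ; rewrite /B2.
    by case: eqP => // ik; rewrite -ik iJ in kJ.
  move=> <-; congr (P _); apply/seteqP; split => w /=.
    move=> [wJ wB] i /= /setU1P[->|iJ]; first by rewrite /B2 eqxx.
    by rewrite /B2; case: eqP => [->//|_]; exact: wJ.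
  move=> H; split.
    move=> i /= iJ; have /= := H i (setU1r _ iJ); rewrite /B2.
    by case: eqP => // ik; rewrite -ik iJ in kJ.
  by have /= := H k (setU11 _ _); rewrite /B2 eqxx.
- move=> _ /=; rewrite /mrestr setTI.
  by rewrite (le_lt_trans (probability_le1 _ _)) ?ltry.
Qed.

Lemma sigmaT_sub J (A : set T) : <<s rect_sets J >> A -> measurable A.
Proof.
apply: smallest_sub; last exact: rect_sets_measurable.
exact: sigma_algebra_measurable.
Qed.

Lemma measurable_sigmaT J : measurable_fun setT (idfun : T -> sigmaT J).
Proof.
by move=> _ A mA; rewrite setTI; exact: sigmaT_sub mA.
Qed.

Lemma measurable_fun_sigmaT d' (T' : measurableType d') J (f : T -> T') :
  measurable_fun setT (f : sigmaT J -> T') -> measurable_fun setT f.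
Proof.
by move=> mf _ A mA; apply: (@sigmaT_sub J); exact: mf.
Qed.

Lemma measurable_X_sigmaT J k : k \in J ->
  measurable_fun setT (X k : sigmaT J -> R).
Proof.
move=> kJ _ B mB; rewrite setTI; apply: sub_sigma_algebra.
exists (fun i => if i == k then B else setT); split.
  by move=> i; case: ifP.
apply/seteqP; split => [w Bw i /= iJ|w /(_ k kJ) /=]; last by rewrite eqxx.
by case: eqP => [->|].
Qed.

Lemma sigmaT_subset d' (T' : measurableType d') J K (f : T -> T') : J \subset K ->
  measurable_fun setT (f : sigmaT J -> T') ->
  measurable_fun setT (f : sigmaT K -> T').
Proof.
move=> JK mf _ A mA; have := mf measurableT A mA.
apply: sub_sigma_algebra2 => _ [B [mB ->]].
exists (fun i => if i \in J then B i else setT); split.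
  by move=> i; case: ifP.
apply/seteqP; split => w H i /= iJ; first by case: ifP => // /H.
by have /= := H i (fintype.subsetP JK _ iJ); rewrite iJ.
Qed.

(** Freezing: [X k] is integrated out while everything that depends on the family [J] is held
    fixed. *)
Lemma integral_indep k J (f : R -> sigmaT J -> \bar R) : k \notin J ->
  measurable_fun [set: measurableTypeR R * sigmaT J] (fun z => f z.1 z.2) ->
  (forall x w, (0 <= f x w)%E) ->
  (\int[P]_w f (X k w) w = \int[P]_w \int[distribution P (X k)]_x f x w)%E.
Proof.
move=> kJ mf f0.
pose im : {mfun T >-> sigmaT J} := HB.pack (idfun : T -> sigmaT J)
  (isMeasurableFun.Build _ _ _ _ _ (@measurable_sigmaT J)).
have kim A B : measurable A -> measurable B ->
  (P (X k @^-1` A `&` im @^-1` B) = P (X k @^-1` A) * P (im @^-1` B))%E.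
  by move=> mA mB; rewrite (indep_sigma kJ mA).
exact: (integral_independent kim (f := fun z => f z.1 z.2)).
Qed.

End IndependentFamilies.

(** * Gaussian integrals of exponentials of quadratic polynomials *)

Section GaussianIntegral.
Context (R : realType).
Local Notation mu := (@lebesgue_measure R).

Lemma integral_normal_prob (m s : R) (f : R -> \bar R) :
  measurable_fun setT f -> (forall x, (0 <= f x)%E) ->
  (\int[normal_prob m s]_x f x = \int[mu]_x (f x * (normal_pdf m s x)%:E))%E.
Proof.
move=> mf f0.
have dom := @normal_prob_dominates R m s.
rewrite -(@Radon_Nikodym_SigmaFinite.change_of_variables _ _ _ (normal_prob m s) mu dom)//.
have mg := Radon_Nikodym_SigmaFinite.f_integrable dom.
apply: ae_eq_integral => //.
- apply: emeasurable_funM => //; exact: measurable_int mg.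
- apply: emeasurable_funM => //; apply/measurable_EFinP.
  exact: measurable_normal_pdf.
- apply: ae_eqe_mul2l; apply: integral_ae_eq => //.
  + by apply/measurable_EFinP; exact: measurable_normal_pdf.
  + by move=> A _ mA; rewrite -Radon_Nikodym_SigmaFinite.f_integral.
Qed.

(** With this coefficient the quadratic term, density included, is - u^2 x^2 / 2. Completing the
    square leaves a multiple of the normal density of mean b / u^2 and deviation 1 / u; u = 1 is the
    Laplace transform. *)
Lemma integral_normal_expR_quad (u b : R) : 0 < u ->
  (\int[normal_prob 0 1]_x (expR (- ((u ^+ 2 - 1) / 2) * x ^+ 2 + b * x))%:E =
   (u^-1 * expR (b ^+ 2 / (2 * u ^+ 2)))%:E)%E.
Proof.
move=> u0; have un0 : u != 0 by rewrite gt_eqF.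
rewrite integral_normal_prob; last 2 first.
- apply/measurable_EFinP; apply: measurableT_comp => //.
  by apply: measurable_funD; apply: measurable_funM => //; exact: measurable_funX.
- by move=> x; rewrite lee_fin expR_ge0.
transitivity (\int[mu]_x ((u^-1 * expR (b ^+ 2 / (2 * u ^+ 2)))%:E *
    (normal_pdf (b / u ^+ 2) u^-1 x)%:E))%E.
  apply: eq_integral => x _; rewrite -!EFinM; congr (_%:E).
  rewrite !normal_pdfE ?invr_eq0 ?oner_eq0// /normal_peak /normal_fun.
  have -> : Num.sqrt (u^-1 ^+ 2 * pi *+ 2) = u^-1 * Num.sqrt (1 ^+ 2 * pi *+ 2).
    rewrite expr1n mul1r -mulrnAr sqrtrM ?sqr_ge0// sqrtr_sqr gtr0_norm ?invr_gt0//.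
  set c := Num.sqrt _; rewrite (invfM u^-1 c) invrK.
  have -> : u^-1 * expR (b ^+ 2 / (2 * u ^+ 2)) * (u * c^-1 *
      expR (- (x - b / u ^+ 2) ^+ 2 / (u^-1 ^+ 2 *+ 2))) =
    c^-1 * (u^-1 * u) * (expR (b ^+ 2 / (2 * u ^+ 2)) *
      expR (- (x - b / u ^+ 2) ^+ 2 / (u^-1 ^+ 2 *+ 2))) by ring.
  rewrite mulVf// mulr1 mulrCA -!expRD; congr (_ * expR _).
  by field.
rewrite ge0_integralZl//; last 3 first.
- by apply/measurable_EFinP; exact: measurable_normal_pdf.
- by move=> x _; rewrite lee_fin normal_pdf_ge0.
- by rewrite lee_fin mulr_ge0 ?expR_ge0// invr_ge0 ltW.
by rewrite integral_normal_pdf mule1.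
Qed.

End GaussianIntegral.

Lemma measurable_sum_seq d (T : measurableType d) (R : realType) (D : set T)
    (A : eqType) (r : seq A) (f : A -> T -> R) :
  (forall i, i \in r -> measurable_fun D (f i)) ->
  measurable_fun D (fun w => \sum_(i <- r) f i w).
Proof.
elim: r => [_|i r ih mf]; first by under eq_fun do rewrite big_nil; exact: measurable_cst.
under eq_fun do rewrite big_cons; apply: measurable_funD.
  by apply: mf; rewrite mem_head.
by apply: ih => j jr; apply: mf; rewrite inE jr orbT.
Qed.

Lemma probability_le_integral d (T : measurableType d) (R : realType)
    (P : probability T R) (A : set T) (g : T -> R) :
  measurable A -> measurable_fun setT g -> (forall w, 0 <= g w) ->
  (forall w, A w -> 1 <= g w) -> (P A <= \int[P]_w (g w)%:E)%E.
Proof.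
move=> mA mg g0 g1; rewrite -[P A](_ : \int[P]_w (\1_A w)%:E = _)%E; last first.
  by rewrite integral_indic// setIT.
apply: ge0_le_integral => //.
- by apply/measurable_EFinP; exact: measurable_indic.
- exact/measurable_EFinP.
- move=> w _; rewrite lee_fin indicE; case: (boolP (w \in A)) => [/set_mem/g1//|_]; exact: g0.
Qed.

(** * Exponential moments of independent Gaussian families *)

Section GaussianFamily.
Context d (T : measurableType d) (R : realType) (P : probability T R).
Context (I : finType) (X : I -> {RV P >-> R}).
Hypothesis iidX : iid_std_gaussian X.
Implicit Types (J K : {set I}) (k : I).

Notation sigmaT J := (g_sigma_algebraType (rect_sets X J)).
Notation sigma_measurable J f := (measurable_fun [set: sigmaT J] (f : sigmaT J -> R)).

Lemma integral_distribution_normal k (f : R -> \bar R) :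
  measurable_fun setT f -> (forall x, (0 <= f x)%E) ->
  (\int[distribution P (X k)]_x f x = \int[normal_prob 0 1]_x f x)%E.
Proof.
move=> mf f0.
have mid : measurable_fun [set: measurableTypeR R] (idfun : measurableTypeR R -> R).
  by move=> _ A mA; rewrite setTI.
pose i : {mfun measurableTypeR R >-> R} := HB.pack (idfun : measurableTypeR R -> R)
  (isMeasurableFun.Build _ _ _ _ _ mid).
transitivity (\int[distribution (normal_prob 0 1) i]_x f x)%E.
  by apply: eq_measure_integral => A mA _; case: iidX => _; exact.
by rewrite ge0_integral_pushforward.
Qed.

Lemma integral_expR_quad_indep k J (u : R) (b h : T -> R) : k \notin J -> 0 < u ->
  sigma_measurable J b -> sigma_measurable J h -> (forall w, 0 <= h w) ->
  (\int[P]_w (expR (- ((u ^+ 2 - 1) / 2) * X k w ^+ 2 + b w * X k w) * h w)%:E =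
   \int[P]_w (u^-1 * expR (b w ^+ 2 / (2 * u ^+ 2)) * h w)%:E)%E.
Proof.
move=> kJ u0 mb mh h0; case: iidX => indX gaussX.
have mz : measurable_fun [set: measurableTypeR R * sigmaT J]
    (fun z => expR (- ((u ^+ 2 - 1) / 2) * z.1 ^+ 2 + b z.2 * z.1) * h z.2).
  apply: measurable_funM; last exact: measurableT_comp.
  apply: measurableT_comp => //; apply: measurable_funD.
    by apply: measurable_funM => //; exact: measurable_funX.
  by apply: measurable_funM => //; exact: measurableT_comp.
rewrite (@integral_indep _ _ _ _ _ _ indX k J (fun x w =>
  (expR (- ((u ^+ 2 - 1) / 2) * x ^+ 2 + b w * x) * h w)%:E) kJ); last 2 first.
- exact/measurable_EFinP.
- by move=> x w; rewrite lee_fin mulr_ge0 ?expR_ge0.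
apply: eq_integral => w _.
transitivity (\int[normal_prob 0 1]_x
    (expR (- ((u ^+ 2 - 1) / 2) * x ^+ 2 + b w * x) * h w)%:E)%E.
  apply: integral_distribution_normal.
    apply/measurable_EFinP; apply: measurable_funM => //; apply: measurableT_comp => //.
    by apply: measurable_funD; apply: measurable_funM => //; exact: measurable_funX.
  by move=> x; rewrite lee_fin mulr_ge0 ?expR_ge0.
under eq_integral do rewrite EFinM.
rewrite ge0_integralZr//.
- by rewrite integral_normal_expR_quad// EFinM.
- apply/measurable_EFinP; apply: measurableT_comp => //.
  by apply: measurable_funD; apply: measurable_funM => //; exact: measurable_funX.
- by rewrite lee_fin.
Qed.

(* The weights [c] are independent of the variables in [r], so that integrating
   these out one at a time removes the factors of the exponential martingale. *)
Lemma integral_expR_linear (r : seq I) J (c : I -> T -> R) :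
  uniq r -> {in r, forall k, k \notin J} ->
  (forall k, sigma_measurable J (c k)) ->
  (\int[P]_w (expR (\sum_(k <- r) (c k w * X k w - c k w ^+ 2 / 2)))%:E = 1)%E.
Proof.
elim: r J => [|k r ih] J /=.
  move=> _ _ _; under eq_integral do rewrite big_nil expR0.
  rewrite -[RHS](probability_setT P) -[RHS]mul1e -integral_cst//.
move=> /andP[kr ur] kJ mc; rewrite -[RHS](ih J)//; last first.
  by move=> j jr; apply: kJ; rewrite inE jr orbT.
(* [J'] contains all that the weights and the remaining factors depend on, but not [k]. *)
pose J' := J :|: [set j in r].
have sub : J \subset J' by exact: finset.subsetUl.
have mc' j : sigma_measurable J' (c j) by apply: sigmaT_subset (mc j).
have kJ' : k \notin J'.
  by rewrite !inE negb_or kr andbT; apply: kJ; rewrite mem_head.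
pose h w := expR (\sum_(j <- r) (c j w * X j w - c j w ^+ 2 / 2) - c k w ^+ 2 / 2).
have mh : sigma_measurable J' h.
  apply: measurableT_comp => //; apply: measurable_funB; last first.
    by apply: measurable_funM => //; exact: measurable_funX.
  apply: measurable_sum_seq => j jr; apply: measurable_funB; last first.
    by apply: measurable_funM => //; exact: measurable_funX.
  apply: measurable_funM => //; apply: measurable_X_sigmaT.
  by rewrite !inE jr orbT.
transitivity (\int[P]_w (expR (- ((1 ^+ 2 - 1) / 2) * X k w ^+ 2 + c k w * X k w) * h w)%:E)%E.
  apply: eq_integral => w _; congr (_%:E); rewrite big_cons -expRD; congr expR.
  by ring.
rewrite (integral_expR_quad_indep kJ')//; last by move=> w; exact: expR_ge0.
apply: eq_integral => w _; congr (_%:E).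
rewrite -mulrA -expRD invr1 mul1r; congr expR; by field.
Qed.

(* Integrating out [X k] replaces [t] with [t'] such that
   [1 / t' = 1 / t + 2 * a k ^+ 2], and the normalizing factors telescope. *)
Lemma integral_expR_sqr (r : seq I) J (a : I -> R) (t : R) (b h : T -> R) :
  uniq r -> {in r, forall k, k \notin J} -> 0 <= t ->
  sigma_measurable J b -> sigma_measurable J h -> (forall w, 0 <= h w) ->
  let q := 1 + 2 * t * \sum_(k <- r) a k ^+ 2 in
  (\int[P]_w (expR (- t * (\sum_(k <- r) a k * X k w + b w) ^+ 2) * h w)%:E =
   \int[P]_w (Num.sqrt q^-1 * expR (- (t / q) * b w ^+ 2) * h w)%:E)%E.
Proof.
move=> + + + mb; elim: r t h => [|k r ih] t h /=.
  move=> _ _ t0 _ _; rewrite big_nil mulr0 addr0 divr1 invr1 sqrtr1.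
  by apply: eq_integral => w _; rewrite big_nil add0r mul1r.
move=> /andP[kr ur] kJ t0 mh h0.
have rJ : {in r, forall k, k \notin J} by move=> j jr; apply: kJ; rewrite inE jr orbT.
have u2 : 0 < 1 + 2 * t * a k ^+ 2 by have := mulr_ge0 t0 (sqr_ge0 (a k)); nra.
pose u := Num.sqrt (1 + 2 * t * a k ^+ 2).
have u0 : 0 < u by rewrite sqrtr_gt0.
have uE : u ^+ 2 = 1 + 2 * t * a k ^+ 2 by rewrite sqr_sqrtr// ltW.
pose J' := J :|: [set j in r].
have sub : J \subset J' by exact: finset.subsetUl.
have kJ' : k \notin J'.
  by rewrite !inE negb_or kr andbT; apply: kJ; rewrite mem_head.
pose b' w := \sum_(j <- r) a j * X j w + b w.
have mb' : sigma_measurable J' b'.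
  apply: measurable_funD; last exact: sigmaT_subset mb.
  apply: measurable_sum_seq => j jr; apply: measurable_funM => //.
  by apply: measurable_X_sigmaT; rewrite !inE jr orbT.
pose h' w := expR (- t * b' w ^+ 2) * h w.
have mh' : sigma_measurable J' h'.
  apply: measurable_funM; last exact: sigmaT_subset mh.
  by apply: measurableT_comp => //; apply: measurable_funM => //; exact: measurable_funX.
transitivity (\int[P]_w (expR (- ((u ^+ 2 - 1) / 2) * X k w ^+ 2 +
    (- (2 * t * a k) * b' w) * X k w) * h' w)%:E)%E.
  apply: eq_integral => w _; congr (_%:E); rewrite /h' mulrA -expRD; congr (expR _ * _).
  by rewrite big_cons uE /b'; field.
rewrite (integral_expR_quad_indep kJ')//; first last.
- by move=> w; rewrite mulr_ge0// expR_ge0.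
- exact: measurable_funM.
pose t' := t / u ^+ 2.
have t'0 : 0 <= t' by rewrite divr_ge0// sqr_ge0.
transitivity (\int[P]_w (expR (- t' * (\sum_(k <- r) a k * X k w + b w) ^+ 2) * (u^-1 * h w))%:E)%E.
  apply: eq_integral => w _; congr (_%:E); rewrite /h'.
  rewrite -mulrA (mulrA (expR _) _ (h w)) -expRD [RHS]mulrCA; congr (_ * (expR _ * _)).
  rewrite -/(b' w) /t'; have un0 : u != 0 by rewrite gt_eqF.
  have -> : - t' * b' w ^+ 2 = - t * b' w ^+ 2 + (2 * t * a k * b' w) ^+ 2 / (2 * u ^+ 2).
    by rewrite /t' uE; field; rewrite gt_eqF.
  by rewrite mulNr sqrrN addrC.
rewrite ih//; last 2 first.
- exact: measurable_funM.
- by move=> w; rewrite mulr_ge0// invr_ge0 ltW.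
apply: eq_integral => w _; congr (_%:E).
set q' := 1 + 2 * t' * _.
have qE : 1 + 2 * t * (\sum_(j <- k :: r) a j ^+ 2) = u ^+ 2 * q'.
  by rewrite big_cons /q' /t' uE; field; rewrite gt_eqF.
rewrite qE invfM sqrtrM ?invr_ge0 ?sqr_ge0// -exprVn sqrtr_sqr gtr0_norm ?invr_gt0//.
rewrite (_ : t * (u^-1 ^+ 2 * q'^-1) = t' / q'); last by rewrite /t' exprVn mulrA.
by ring.
Qed.

(** Laplace transform of |x|^2 times a chi-squared variable: distinct rows use disjoint variables
    since [ix] is injective, so each row contributes one factor. *)
Lemma integral_expR_sqr_rows (A B : finType) (ix : A -> B -> I) (x : B -> R) (t : R)
    (r : seq A) : injective (fun z => ix z.1 z.2) -> uniq r -> 0 <= t ->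
  (\int[P]_w (expR (- t * \sum_(i <- r) (\sum_j x j * X (ix i j) w) ^+ 2))%:E =
   (Num.sqrt (1 + 2 * t * \sum_j x j ^+ 2)^-1 ^+ size r)%:E)%E.
Proof.
move=> ixI + t0; elim: r => [_|i r ih /= /andP[ir ur]].
  under eq_integral do rewrite big_nil mulr0 expR0.
  by rewrite expr0 -[RHS](probability_setT P) -[RHS]mul1e -integral_cst//.
pose J := [set ix z.1 z.2 | z : A * B & z.1 \in r]%SET.
pose h w := expR (- t * \sum_(i <- r) (\sum_j x j * X (ix i j) w) ^+ 2).
have mh : sigma_measurable J h.
  apply: measurableT_comp => //; apply: measurable_funM => //.
  apply: measurable_sum_seq => i' i'r; apply: measurable_funX.
  apply: measurable_sum => j; apply: measurable_funM => //.
  by apply: measurable_X_sigmaT; apply/imsetP; exists (i', j); rewrite ?inE.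
pose s := [seq ix i j | j <- enum B].
have us : uniq s.
  rewrite map_inj_uniq ?enum_uniq// => j j' /= jj'.
  by have [] := ixI (i, j) (i, j') jj'.
have sJ : {in s, forall k, k \notin J}.
  move=> _ /mapP[j _ ->]; apply/negP => /imsetP[[i' j']]; rewrite inE/= => i'r.
  by move/(ixI (i, j) (i', j')) => [ii' _]; rewrite ii' i'r in ir.
(* The vector [x] transported to weights on [I], the form taken by [integral_expR_sqr]. *)
pose a k := \sum_(j | ix i j == k) x j.
have aE j : a (ix i j) = x j.
  rewrite /a (big_pred1 j)// => j' /=; apply/eqP/eqP => [|->//].
  by move/(ixI (i, j') (i, j)) => [].
have sE (f : I -> R) : \sum_(k <- s) f k = \sum_j f (ix i j).
  by rewrite big_map big_enum.
have := @integral_expR_sqr s J a t (cst 0) h us sJ t0 (measurable_cst _) mh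
  (fun w => expR_ge0 _).
rewrite sE /= => H.
transitivity (\int[P]_w (expR (- t * (\sum_(k <- s) a k * X k w + 0) ^+ 2) * h w)%:E)%E.
  apply: eq_integral => w _; congr (_%:E); rewrite big_cons mulrDr expRD.
  by rewrite addr0 sE; congr (expR (_ * _ ^+ 2) * _); apply: eq_bigr => j _; rewrite aE.
rewrite H; under eq_bigr do rewrite aE.
under eq_integral do rewrite expr0n/= mulr0 expR0 mulr1 EFinM.
rewrite ge0_integralZl//; first last.
- by move=> w _; rewrite lee_fin expR_ge0.
- by apply/measurable_EFinP; exact: measurable_fun_sigmaT mh.
by rewrite ih// exprS EFinM.
Qed.

End GaussianFamily.

Lemma expR1_le3 (R : realType) : expR 1 <= 3 :> R.
Proof.
have h : 7 / 8 <= expR (- (1 / 8)) :> R by apply: le_trans (expR_ge1Dx _); lra.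
have : (7 / 8) ^+ 8 <= expR (- 1) :> R.
  rewrite [X in expR X](_ : - 1 = - (1 / 8) * 8%:R); last by lra.
  by rewrite expRM_natr lerXn2r ?nnegrE ?expR_ge0//; lra.
rewrite expRN -[X in _ <= X]mul1r ler_pdivlMr ?expR_gt0// => h2.
have := expR_gt0 (1 : R); nra.
Qed.

Lemma measurable_lt_set d (T : measurableType d) (R : realType) (f g : T -> R) :
  measurable_fun setT f -> measurable_fun setT g ->
  measurable [set w | f w < g w].
Proof.
move=> mf mg; rewrite -[X in measurable X]setTI.
have mtrue : measurable [set true] by [].
exact: measurable_fun_ltr mf mg measurableT _ mtrue.
Qed.

Lemma measurable_le_set d (T : measurableType d) (R : realType) (f g : T -> R) :
  measurable_fun setT f -> measurable_fun setT g ->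
  measurable [set w | f w <= g w].
Proof.
move=> mf mg; rewrite -[X in measurable X]setTI.
have mtrue : measurable [set true] by [].
exact: measurable_fun_ler mf mg measurableT _ mtrue.
Qed.

(** * Chernoff bounds *)

Section GaussianTails.
Context d (T : measurableType d) (R : realType) (P : probability T R).
Context (I : finType) (X : I -> {RV P >-> R}).
Hypothesis iidX : iid_std_gaussian X.
Implicit Types (J K : {set I}) (k : I).

Notation sigmaT J := (g_sigma_algebraType (rect_sets X J)).
Notation sigma_measurable J f := (measurable_fun [set: sigmaT J] (f : sigmaT J -> R)).

Section LinearTail.
Variables (r : seq I) (J : {set I}) (s2 a : R).
Hypotheses (ur : uniq r) (rJ : {in r, forall k, k \notin J}) (s20 : 0 < s2) (a0 : 0 < a).

(** The compensated exponential has mean 1 even for random weights, and on the event the compensator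
    is at most th^2 s2 / 2; this replaces conditioning on the weights. *)
Lemma linear_tail_upper (c : I -> T -> R) : (forall k, sigma_measurable J (c k)) ->
  let A := [set w | a < \sum_(k <- r) c k w * X k w] `&`
           [set w | \sum_(k <- r) c k w ^+ 2 <= s2] in
  measurable A /\ (P A <= (expR (- (a ^+ 2 / (2 * s2))))%:E)%E.
Proof.
move=> mc A.
have mc' k : measurable_fun setT (c k) by exact: measurable_fun_sigmaT (mc k).
have mA : measurable A.
  apply: measurableI.
    by apply: measurable_lt_set => //; apply: measurable_sum => k; exact: measurable_funM.
  by apply: measurable_le_set => //; apply: measurable_sum => k; exact: measurable_funX.
split => //.
(* The minimizer of - th a + th^2 s2 / 2. *)
pose th := a / s2.
pose g w := expR (\sum_(k <- r) (th * c k w * X k w - (th * c k w) ^+ 2 / 2)).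
have mg : measurable_fun setT g.
  apply: measurableT_comp => //; apply: measurable_sum => k; apply: measurable_funB.
    by apply: measurable_funM => //; exact: measurable_funM.
  by apply: measurable_funM => //; apply: measurable_funX; exact: measurable_funM.
pose C := expR (- (a ^+ 2 / (2 * s2))).
rewrite -/C.
apply: (@le_trans _ _ (\int[P]_w ((fun w => C * g w) w)%:E)%E).
  apply: probability_le_integral => //=.
- exact: measurable_funM.
- by move=> w; rewrite mulr_ge0// expR_ge0.
- move=> w [/= aw sw]; rewrite /C /g -expRD -[leLHS]expR0 ler_expR.
  have -> : \sum_(k <- r) (th * c k w * X k w - (th * c k w) ^+ 2 / 2) =
      th * \sum_(k <- r) c k w * X k w - th ^+ 2 / 2 * \sum_(k <- r) c k w ^+ 2.
    by rewrite !mulr_sumr -sumrB; apply: eq_bigr => k _; ring.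
  have th0 : 0 < th by rewrite divr_gt0.
  have h1 : th * a <= th * \sum_(k <- r) c k w * X k w by rewrite ler_pM2l// ltW.
  have h2 : th ^+ 2 / 2 * \sum_(k <- r) c k w ^+ 2 <= th ^+ 2 / 2 * s2.
    by rewrite ler_pM2l// divr_gt0// exprn_gt0.
  have h3 : - (a ^+ 2 / (2 * s2)) + th * a - th ^+ 2 / 2 * s2 = 0.
    by rewrite /th; field; rewrite gt_eqF.
  lra.
- under eq_integral do rewrite EFinM.
  rewrite ge0_integralZl//; last 3 first.
  + exact/measurable_EFinP.
  + by move=> w _; rewrite lee_fin expR_ge0.
  + by rewrite lee_fin expR_ge0.
  rewrite (integral_expR_linear iidX (J := J) (c := fun k w => th * c k w))// ?mule1//.
  by move=> k; exact: measurable_funM.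
Qed.

Lemma linear_tail (c : I -> T -> R) : (forall k, sigma_measurable J (c k)) ->
  let A := [set w | a < `|\sum_(k <- r) c k w * X k w| /\
                    \sum_(k <- r) c k w ^+ 2 <= s2] in
  measurable A /\ (P A <= (2 * expR (- (a ^+ 2 / (2 * s2))))%:E)%E.
Proof.
move=> mc A.
have [mA1 PA1] := linear_tail_upper mc.
have mNc k : sigma_measurable J (fun w => - c k w) by exact: measurable_funN.
have [mA2 PA2] := linear_tail_upper mNc.
have AE : A = ([set w | a < \sum_(k <- r) c k w * X k w] `&`
           [set w | \sum_(k <- r) c k w ^+ 2 <= s2]) `|`
    ([set w | a < \sum_(k <- r) - c k w * X k w] `&`
           [set w | \sum_(k <- r) (- c k w) ^+ 2 <= s2]).
  have NX w : \sum_(k <- r) - c k w * X k w = - \sum_(k <- r) c k w * X k w.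
    by rewrite -sumrN; apply: eq_bigr => k _; rewrite mulNr.
  have N2 w : \sum_(k <- r) (- c k w) ^+ 2 = \sum_(k <- r) c k w ^+ 2.
    by apply: eq_bigr => k _; rewrite sqrrN.
  apply/seteqP; split => w /=; rewrite !NX !N2.
    by move=> [+ sw]; rewrite ltr_normr => /orP[]; [left|right].
  by move=> [] [aw sw]; split => //; rewrite ltr_normr aw ?orbT.
rewrite AE; split; first exact: measurableU.
rewrite (_ : 2 = 1 + 1)// mulrDl mul1r EFinD; apply: le_trans (leeD PA1 PA2).
exact: measureU2.
Qed.

End LinearTail.

(** Chernoff at t = 1 / |x|^2: each row contributes 3^(-1/2) <= e^(-1/2), because e <= 3, and the
    threshold contributes e^(m/3), where m is the number of rows. The total exponent is m/3 - m/2 =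
    - m/6. *)
Lemma chi2_lower_tail (A B : finType) (ix : A -> B -> I) (x : B -> R) :
  injective (fun z => ix z.1 z.2) ->
  let E := [set w | \sum_i (\sum_j x j * X (ix i j) w) ^+ 2 <
                    #|A|%:R / 3 * \sum_j x j ^+ 2] in
  measurable E /\ (P E <= (expR (- (#|A|%:R / 6)))%:E)%E.
Proof.
move=> ixI E; set q := \sum_j x j ^+ 2.
have mS : measurable_fun setT (fun w => \sum_i (\sum_j x j * X (ix i j) w) ^+ 2).
  apply: measurable_sum => i; apply: measurable_funX.
  by apply: measurable_sum => j; exact: measurable_funM.
have mE : measurable E by exact: measurable_lt_set.
split => //.
have q0 : 0 <= q by apply: sumr_ge0 => j _; exact: sqr_ge0.
have [q1|q1] := eqVneq q 0.
  rewrite (_ : E = set0) ?measure0 ?lee_fin ?expR_ge0//.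
  apply/seteqP; split => // w; rewrite /E/= -/q q1 mulr0 => h.
  have : 0 <= \sum_i (\sum_j x j * X (ix i j) w) ^+ 2.
    by apply: sumr_ge0 => j _; exact: sqr_ge0.
  lra.
have qp : 0 < q by rewrite lt_def q1.
pose m : R := #|A|%:R.
pose g w := expR (- q^-1 * \sum_i (\sum_j x j * X (ix i j) w) ^+ 2).
have mg : measurable_fun setT g.
  by apply: measurableT_comp => //; exact: measurable_funM.
apply: (@le_trans _ _ (\int[P]_w ((fun w => expR (m / 3) * g w) w)%:E)%E).
  apply: probability_le_integral => //=.
- exact: measurable_funM.
- by move=> w; rewrite mulr_ge0// expR_ge0.
- move=> w /= h; rewrite /g -expRD -[leLHS]expR0 ler_expR.
  have : q^-1 * \sum_i (\sum_j x j * X (ix i j) w) ^+ 2 <= q^-1 * (m / 3 * q).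
    by rewrite ler_pM2l ?invr_gt0// ltW.
  by rewrite mulrCA mulVf// mulr1; lra.
- under eq_integral do rewrite EFinM.
  rewrite ge0_integralZl//; last 2 first.
  + exact/measurable_EFinP.
  + by move=> w _; rewrite lee_fin expR_ge0.
  have := @integral_expR_sqr_rows _ _ _ _ _ X iidX A B ix x q^-1 (enum A) ixI (enum_uniq _).
  rewrite invr_ge0 q0 => /(_ isT) H.
  have -> : (\int[P]_w (g w)%:E = (Num.sqrt (1 + 2 * q^-1 * q)^-1 ^+ size (enum A))%:E)%E.
    rewrite -[RHS]H; apply: eq_integral => w _.
    by rewrite /g big_enum.
  rewrite -EFinM lee_fin -/q -mulrA mulVf// -cardE.
  have h : Num.sqrt (1 + 2 * 1)^-1 <= expR (- (1 / 2)) :> R.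
    rewrite -[leRHS]gtr0_norm ?expR_gt0// -sqrtr_sqr ler_sqrt ?exprn_gt0 ?expR_gt0//.
    rewrite -expRM_natr (_ : - (1 / 2) * 2 = -1); last by lra.
    have e3 := expR1_le3 R.
    by rewrite expRN lef_pV2 ?posrE ?expR_gt0//; lra.
  have h2 : Num.sqrt (1 + 2 * 1)^-1 ^+ #|A| <= expR (- (1 / 2) * m).
    by rewrite expRM_natr lerXn2r ?nnegrE ?expR_ge0 ?sqrtr_ge0.
  apply: (le_trans (ler_wpM2l (expR_ge0 _) h2)).
  by rewrite -expRD ler_expR /m; lra.
Qed.

End GaussianTails.

(** * Perturbation of the optimality conditions *)

Lemma norm2_sqr (R : realType) n (x : 'cV[R]_n) : norm2 x ^+ 2 = \sum_i x i 0 ^+ 2.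
Proof. by rewrite sqr_sqrtr// sumr_ge0// => i _; exact: sqr_ge0. Qed.

Lemma supp_outside (R : realType) n (x : 'cV[R]_n) j : j \notin supp x -> x j 0 = 0.
Proof. by rewrite inE negbK => /eqP. Qed.

(** Expand the sum of the squared deviations of [f] from its mean on [S]. *)
Lemma sqr_sum_le_card (R : realType) (I : finType) (S : {set I}) (f : I -> R) :
  (\sum_(j in S) f j) ^+ 2 <= #|S|%:R * \sum_(j in S) f j ^+ 2.
Proof.
have [->|S0] := eqVneq S finset.set0.
  by rewrite !big_set0 cards0 mul0r expr0n.
have s0 : 0 < #|S|%:R :> R by rewrite ltr0n card_gt0.
set H := \sum_(j in S) f j; pose a := H / #|S|%:R.
have : 0 <= \sum_(j in S) (f j - a) ^+ 2 by apply: sumr_ge0 => j _; exact: sqr_ge0.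
have -> : \sum_(j in S) (f j - a) ^+ 2 =
    \sum_(j in S) f j ^+ 2 - 2 * a * H + #|S|%:R * a ^+ 2.
  transitivity (\sum_(j in S) (f j ^+ 2 + - (2 * a) * f j + a ^+ 2)).
    by apply: eq_bigr => j _; ring.
  by rewrite !big_split/= -mulr_sumr sumr_const -[a ^+ 2 *+ _]mulr_natl mulNr -/H.
have -> : \sum_(j in S) f j ^+ 2 - 2 * a * H + #|S|%:R * a ^+ 2 =
    \sum_(j in S) f j ^+ 2 - H ^+ 2 / #|S|%:R by rewrite /a; field; rewrite gt_eqF.
by rewrite subr_ge0 ler_pdivrMr// mulrC.
Qed.

Section Columns.
Context (R : realType) (m n : nat).
Implicit Types (A : 'M[R]_(m, n)) (x h : 'cV[R]_n) (r : 'cV[R]_m).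

Definition coldot A r (j : 'I_n) : R := \sum_i A i j * r i 0.

Lemma sum_mulmx_dot A h r :
  \sum_i (A *m h) i 0 * r i 0 = \sum_j h j 0 * coldot A r j.
Proof.
under eq_bigr do rewrite mxE mulr_suml.
rewrite exchange_big/=; apply: eq_bigr => j _; rewrite /coldot mulr_sumr.
by apply: eq_bigr => i _; ring.
Qed.

Lemma norm2_mulmx A h : norm2 (A *m h) ^+ 2 = \sum_j h j 0 * coldot A (A *m h) j.
Proof. by rewrite norm2_sqr -sum_mulmx_dot; apply: eq_bigr => i _; rewrite expr2. Qed.

Lemma coldotB A r r' j : coldot A (r - r') j = coldot A r j - coldot A r' j.
Proof. by rewrite /coldot -sumrB; apply: eq_bigr => i _; rewrite !mxE mulrBr. Qed.

Lemma coldotD A r r' j : coldot A (r + r') j = coldot A r j + coldot A r' j.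
Proof. by rewrite /coldot -big_split; apply: eq_bigr => i _; rewrite !mxE mulrDr. Qed.

Lemma coldotZ A c r j : coldot A (c *: r) j = c * coldot A r j.
Proof. by rewrite /coldot mulr_sumr; apply: eq_bigr => i _; rewrite !mxE mulrCA. Qed.

Lemma lasso_obj_shift lam y A x h :
  lasso_obj lam y A (x + h) = norm2 (A *m h) ^+ 2
    - 2 * (\sum_j h j 0 * coldot A (y - A *m x) j)
    + norm2 (A *m x - y) ^+ 2 + lam * norm1 (x + h).
Proof.
rewrite /lasso_obj -sum_mulmx_dot !norm2_sqr; congr (_ + _).
rewrite mulr_sumr -sumrB -big_split/=; apply: eq_bigr => i _.
by rewrite mulmxDr !mxE; ring.
Qed.

Lemma normr_mulmx_le A x (M : R) i : (forall i j, `|A i j| <= M) ->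
  `|(A *m x) i 0| <= M * \sum_j `|x j 0|.
Proof.
move=> AM; rewrite mxE mulr_sumr; apply: le_trans (ler_norm_sum _ _ _) _.
by apply: ler_sum => j _; rewrite normrM ler_wpM2r.
Qed.

Lemma normr_coldot_le A r (M c : R) j : (forall i j, `|A i j| <= M) ->
  (forall i, `|r i 0| <= c) -> `|coldot A r j| <= m%:R * (M * c).
Proof.
move=> AM rc; apply: le_trans (ler_norm_sum _ _ _) _.
rewrite -[X in X%:R * _]card_ord mulr_natl -sumr_const; apply: ler_sum => i _.
by rewrite normrM ler_pM.
Qed.

End Columns.

(** * Support of a minimizer near an approximate solution of the optimality conditions *)

Section ApproximateKKT.
Context (R : realType) (m n : nat) (lam : R) (y : 'cV[R]_m) (A : 'M[R]_(m, n)).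
Context (S : {set 'I_n}) (x0 z : 'cV[R]_n) (q e : 'I_n -> R) (rho eta gam M : R).
Hypotheses (lam0 : 0 < lam) (rho0 : 0 <= rho) (eta0 : 0 < eta) (gam0 : 0 < gam).
Hypothesis x0S : forall j, j \notin S -> x0 j 0 = 0.
Hypothesis e1 : forall j, `|e j| <= 1.
Hypothesis ex0 : forall j, j \in S -> e j * x0 j 0 = `|x0 j 0|.
Hypothesis grad : forall j, coldot A (y - A *m x0) j = lam / 2 * q j.
Hypothesis qS : forall j, j \in S -> `|q j - e j| <= rho.
Hypothesis qC : forall j, j \notin S -> `|q j| <= 1 - eta.
Hypothesis curv : forall h : 'cV[R]_n,
  eta * \sum_(j in ~: S) `|h j 0| <= rho * \sum_(j in S) `|h j 0| ->
  gam * (\sum_(j in S) `|h j 0|) ^+ 2 <= norm2 (A *m h) ^+ 2.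
Hypothesis zsol : lasso_sol lam y A z.

Let h := z - x0.
Let H := \sum_(j in S) `|h j 0|.
Let Hc := \sum_(j in ~: S) `|h j 0|.

Lemma sum_split_set (f : 'I_n -> R) :
  \sum_j f j = \sum_(j in S) f j + \sum_(j in ~: S) f j.
Proof.
rewrite (bigID (mem S))/=; congr (_ + _).
by apply: eq_bigl => j; rewrite inE.
Qed.

(** Compare the objective at [z] and at [x0]. On [S] the defect of the subgradient costs at most rho
    |h_j|; outside, the dual margin gains at least eta |h_j|. *)
Lemma kkt_basic : norm2 (A *m h) ^+ 2 + lam * (eta * Hc) <= lam * (rho * H).
Proof.
have := zsol x0.
have zE : z = x0 + h by rewrite /h addrC subrK.
rewrite {1}zE lasso_obj_shift /lasso_obj -zE.
under [\sum_j h j 0 * _]eq_bigr do rewrite grad.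
set N := norm2 (A *m h) ^+ 2; set C := norm2 _ ^+ 2.
have key : - (rho * H) + eta * Hc <= norm1 z - norm1 x0 - \sum_j h j 0 * q j.
  rewrite /norm1 -!sumrB sum_split_set /H /Hc !mulr_sumr -sumrN lerD//.
    apply: ler_sum => j jS.
    have hz : `|z j 0| >= e j * z j 0.
      apply: le_trans (ler_norm _) _; rewrite normrM.
      by rewrite -[leRHS]mul1r ler_wpM2r.
    have -> : `|x0 j 0| = e j * z j 0 - e j * h j 0.
      by rewrite -ex0// zE mxE; ring.
    have : h j 0 * (q j - e j) <= `|h j 0| * rho.
      apply: le_trans (ler_norm _) _; rewrite normrM ler_wpM2l//; exact: qS.
    lra.
  apply: ler_sum => j; rewrite inE => jS.
  have -> : z j 0 = h j 0 by rewrite zE mxE x0S// add0r.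
  rewrite x0S// normr0 subr0.
  have : h j 0 * q j <= `|h j 0| * (1 - eta).
    apply: le_trans (ler_norm _) _; rewrite normrM ler_wpM2l//; exact: qC.
  lra.
have -> : 2 * (\sum_j h j 0 * (lam / 2 * q j)) = lam * \sum_j h j 0 * q j.
  by rewrite !mulr_sumr; apply: eq_bigr => j _; field.
move: key; rewrite -(ler_pM2l lam0); lra.
Qed.

(** [kkt_basic] first places [h] in the cone where [curv] applies, then bounds the quadratic term:
    gam H^2 <= lam rho H. *)
Lemma kkt_l1 : H <= lam * rho / gam.
Proof.
have H0 : 0 <= H by apply: sumr_ge0.
have Hc0 : 0 <= Hc by apply: sumr_ge0.
have kb := kkt_basic.
have N0 : 0 <= norm2 (A *m h) ^+ 2 by exact: sqr_ge0.
have c1 : eta * Hc <= rho * H.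
  by rewrite -(ler_pM2l lam0); lra.
have := curv c1; rewrite -/H => c2.
have [->|Hn] := eqVneq H 0; first by rewrite !mulr_ge0// ?invr_ge0 ltW.
have Hp : 0 < H by rewrite lt_def Hn.
rewrite ler_pdivlMr// -(ler_pM2r Hp).
have : 0 <= lam * (eta * Hc) by rewrite !mulr_ge0// ltW.
lra.
Qed.

Hypothesis AM : forall i j, `|A i j| <= M.
Hypothesis x0_large : forall j, j \in S -> lam * rho / gam < `|x0 j 0|.
Hypothesis small : m%:R * M ^+ 2 * (lam * rho / gam) < lam * eta / 2.

(** On [S], [h] is too small to cancel [x0]. Outside, a nonzero entry is impossible: erasing all
    entries of [z] outside [S] would strictly decrease the objective, the correlations at the erased
    point being below lam / 2. *)
Lemma kkt_supp : supp z = S.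
Proof.
have M0 (i : 'I_m) (j : 'I_n) : 0 <= M by exact: le_trans (normr_ge0 _) (AM i j).
have zE : z = x0 + h by rewrite /h addrC subrK.
have Hl := kkt_l1.
have hl j : j \in S -> `|h j 0| <= lam * rho / gam.
  move=> jS; apply: (le_trans _ Hl); rewrite /H (bigD1 j)//= lerDl.
  exact: sumr_ge0.
have zS j : j \in S -> z j 0 != 0.
  move=> jS; apply/negP => /eqP zj; have := x0_large jS; have := hl j jS.
  have -> : h j 0 = - x0 j 0 by rewrite /h !mxE zj sub0r.
  by rewrite normrN => h1 h2; have := lt_le_trans h2 h1; rewrite ltxx.
suff zC j : j \notin S -> z j 0 = 0.
  apply/setP => j; rewrite inE; have [/zS//|/zC ->] := boolP (j \in S).
  by rewrite eqxx.
move=> jS; apply/eqP; apply: contraT => zj0.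
(* [zSv] is [z] with its entries outside [S] erased, and [hC] consists of the erased entries. *)
pose hS : 'cV[R]_n := \col_i (if i \in S then h i 0 else 0).
pose hC : 'cV[R]_n := \col_i (if i \in S then 0 else z i 0).
pose zSv := x0 + hS.
have zE2 : z = zSv + hC.
  apply/colP => i; rewrite !mxE; case: ifPn => iS; first by rewrite addr0; ring.
  by rewrite x0S// !add0r.
have := zsol zSv; rewrite {1}zE2 lasso_obj_shift /lasso_obj -zE2.
set N := norm2 (A *m hC) ^+ 2; set C := norm2 _ ^+ 2.
have N0 : 0 <= N by exact: sqr_ge0.
have gb i : i \notin S -> 2 * `|coldot A (y - A *m zSv) i| < lam.
  move=> iS; rewrite /zSv mulmxDr opprD addrA coldotB grad.
  apply: (@le_lt_trans _ _ (lam * (1 - eta) + 2 * (m%:R * (M * (M * H))))).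
    have -> : lam * (1 - eta) = 2 * (lam / 2 * (1 - eta)) by field.
    rewrite -mulrDr ler_pM2l//; apply: le_trans (ler_normB _ _) _.
    rewrite normrM gtr0_norm; last by rewrite divr_gt0.
    apply: lerD; first by rewrite ler_wpM2l ?qC// divr_ge0// ltW.
    apply: normr_coldot_le => // k; apply: le_trans (normr_mulmx_le _ _ AM) _.
    rewrite ler_wpM2l ?(M0 k i)// sum_split_set [X in _ + X]big1 ?addr0; last first.
      by move=> l; rewrite inE => lS; rewrite mxE (negbTE lS) normr0.
    by apply: ler_sum => l lS; rewrite mxE lS.
  have : m%:R * (M * (M * H)) <= m%:R * M ^+ 2 * (lam * rho / gam).
    have -> : m%:R * (M * (M * H)) = m%:R * M ^+ 2 * H by ring.
    by rewrite ler_wpM2l// mulr_ge0// sqr_ge0.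
  move=> hX; have := le_lt_trans hX small; set Y := m%:R * _.
  clear M0; rewrite mulrBr mulr1; lra.
clear M0.
have n1E : norm1 z = norm1 zSv + \sum_(i in ~: S) `|z i 0|.
  rewrite /norm1 !sum_split_set -addrA; congr (_ + _).
    by apply: eq_bigr => i iS; rewrite zE2 !mxE iS addr0.
  rewrite [X in _ = X + _]big1 ?add0r// => i; rewrite inE => iS.
  by rewrite !mxE (negbTE iS) x0S// addr0 normr0.
have cross : \sum_i hC i 0 * coldot A (y - A *m zSv) i =
    \sum_(i in ~: S) z i 0 * coldot A (y - A *m zSv) i.
  rewrite sum_split_set [X in X + _]big1 ?add0r.
    by apply: eq_bigr => i; rewrite inE => iS; rewrite mxE (negbTE iS).
  by move=> i iS; rewrite mxE iS mul0r.
rewrite cross n1E => le0.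
have : 0 < lam * \sum_(i in ~: S) `|z i 0| -
    2 * \sum_(i in ~: S) z i 0 * coldot A (y - A *m zSv) i.
  rewrite !mulr_sumr -sumrB (bigD1 j) ?inE//= ltr_pwDl//.
    have : 2 * (z j 0 * coldot A (y - A *m zSv) j) <=
        `|z j 0| * (2 * `|coldot A (y - A *m zSv) j|).
      by rewrite [leRHS]mulrCA ler_pM2l//; apply: le_trans (ler_norm _) _; rewrite normrM.
    have : `|z j 0| * (2 * `|coldot A (y - A *m zSv) j|) < `|z j 0| * lam.
      by rewrite ltr_pM2l ?gb// normr_gt0.
    lra.
  apply: sumr_ge0 => i /andP[]; rewrite inE => iS _.
  have : 2 * (z i 0 * coldot A (y - A *m zSv) i) <=
      `|z i 0| * (2 * `|coldot A (y - A *m zSv) i|).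
    by rewrite [leRHS]mulrCA ler_pM2l//; apply: le_trans (ler_norm _) _; rewrite normrM.
  have : `|z i 0| * (2 * `|coldot A (y - A *m zSv) i|) <= `|z i 0| * lam.
    by rewrite ler_wpM2l// ltW// gb.
  lra.
lra.
Qed.

End ApproximateKKT.

(** * The dual certificate and its bounds *)

Section DualCertificate.
Context (R : realType) (m n : nat).
Implicit Types (A : 'M[R]_(m, n)) (J : {set 'I_n}) (e x : 'cV[R]_n).

(* Extended by the identity outside [J], to avoid reindexing the columns. *)
Definition gram A J : 'M[R]_n :=
  \matrix_(i, j) if (i \in J) && (j \in J) then \sum_k A k i * A k j
                 else (i == j)%:R.

Definition mask_col J e : 'cV[R]_n := \col_j (if j \in J then e j 0 else 0).

(* Cramer's rule for [A_J^T A_J x = e_J], from which measurability in the entries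
   of [A] is immediate. *)
Definition certificate A e J : 'cV[R]_n :=
  (\det (gram A J))^-1 *: (\adj (gram A J) *m mask_col J e).

Variables (A : 'M[R]_(m, n)) (S : {set 'I_n}) (kap : R).
Hypothesis kap0 : 0 < kap.
Hypothesis isom : forall x, (forall j, j \notin S -> x j 0 = 0) ->
  kap * norm2 x ^+ 2 <= norm2 (A *m x) ^+ 2.

Lemma sum_supported (f : 'I_n -> R) J x : (forall j, j \notin J -> x j 0 = 0) ->
  \sum_j x j 0 * f j = \sum_(j in J) x j 0 * f j.
Proof.
move=> xJ; rewrite (bigID (mem J))/= [X in _ + X]big1 ?addr0// => j jJ.
by rewrite xJ// mul0r.
Qed.

Lemma coldot_gram J x j : (forall i, i \notin J -> x i 0 = 0) ->
  coldot A (A *m x) j = \sum_(i in J) x i 0 * \sum_k A k i * A k j.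
Proof.
move=> xJ; rewrite -(sum_supported (fun i => \sum_k A k i * A k j) xJ) /coldot.
under eq_bigr do rewrite mxE mulr_sumr.
rewrite exchange_big/=; apply: eq_bigr => i _; rewrite mulr_sumr.
by apply: eq_bigr => k _; ring.
Qed.

Lemma isom_inj x : (forall j, j \notin S -> x j 0 = 0) ->
  norm2 (A *m x) ^+ 2 <= 0 -> x = 0.
Proof.
move=> xS Ax; have := le_trans (isom xS) Ax.
rewrite pmulr_rle0// norm2_sqr => x0; apply/colP => j; rewrite mxE.
have /eqP : \sum_i x i 0 ^+ 2 = 0.
  by apply/eqP; rewrite eq_le x0 sumr_ge0// => i _; exact: sqr_ge0.
rewrite psumr_eq0; last by move=> i _; exact: sqr_ge0.
by move/allP => /(_ j); rewrite mem_index_enum/= sqrf_eq0 => /(_ isT)/eqP.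
Qed.

(** A kernel vector vanishes outside [J], where the matrix is the identity; its image under [A] is
    then 0, and [isom] applies. *)
Lemma gram_det_neq0 J : J \subset S -> \det (gram A J) != 0.
Proof.
move=> JS; apply/det0P => -[v v0 vG]; move/eqP: v0; apply.
pose x := v^T.
have vGj j : \sum_i v 0 i * gram A J i j = 0.
  by move/rowP: vG => /(_ j); rewrite !mxE.
have xJ j : j \notin J -> x j 0 = 0.
  move=> jJ; rewrite -[RHS](vGj j) (bigD1 j)//= [X in _ + X]big1 ?addr0.
    by rewrite !mxE (negbTE jJ) andbF eqxx mulr1.
  by move=> i ij; rewrite mxE (negbTE jJ) andbF (negbTE ij) mulr0.
have cx j : j \in J -> coldot A (A *m x) j = 0.
  move=> jJ; rewrite (coldot_gram _ xJ) -[RHS](vGj j).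
  rewrite -(sum_supported (fun i => \sum_k A k i * A k j) xJ).
  apply: eq_bigr => i _; rewrite !mxE jJ andbT; case: ifPn => // iJ.
  by have := xJ i iJ; rewrite mxE => ->; rewrite !mul0r.
have xS j : j \notin S -> x j 0 = 0.
  by move=> jS; apply: xJ; apply: contra jS; exact: (fintype.subsetP JS).
have : x = 0.
  apply: isom_inj => //; rewrite norm2_mulmx (sum_supported _ xJ) big1// => j jJ.
  by rewrite cx// mulr0.
by move=> x0; rewrite -[v]trmxK -/x x0 trmx0.
Qed.

Section CertificateProperties.
Variables (e : 'cV[R]_n) (J : {set 'I_n}).
Hypothesis JS : J \subset S.
Let u := certificate A e J.

Lemma gram_certificate : gram A J *m u = mask_col J e.
Proof.
rewrite /u /certificate -scalemxAr mulmxA mul_mx_adj mul_scalar_mx scalerA.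
by rewrite mulVf ?scale1r// gram_det_neq0.
Qed.

Lemma certificate_outside j : j \notin J -> u j 0 = 0.
Proof.
move=> jJ; have /colP/(_ j) := gram_certificate; rewrite mxE [RHS]mxE (negbTE jJ) => H.
rewrite -[RHS]H (bigD1 j)//= [X in _ + X]big1 ?addr0.
  by rewrite [gram _ _ _ _]mxE (negbTE jJ) eqxx mul1r.
by move=> i ij; rewrite [gram _ _ _ _]mxE (negbTE jJ)/= eq_sym (negbTE ij) mul0r.
Qed.

Lemma certificate_coldot j : j \in J -> coldot A (A *m u) j = e j 0.
Proof.
move=> jJ; have /colP/(_ j) := gram_certificate; rewrite mxE [RHS]mxE jJ => <-.
rewrite (coldot_gram _ certificate_outside).
rewrite -(sum_supported (fun i => \sum_k A k i * A k j) certificate_outside).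
apply: eq_bigr => i _; rewrite [gram _ _ _ _]mxE jJ/=; case: ifPn => iJ.
  by rewrite mulrC; congr (_ * _); apply: eq_bigr => k _; rewrite mulrC.
by rewrite certificate_outside// mul0r mulr0.
Qed.

(** The square norm t of [A *m u] is the sum of the u_j e_j, hence at most kap |u|^2 / 2 + |J| / (2
    kap); by [isom] the first term is at most t / 2 and is absorbed. *)
Lemma certificate_image_norm : (forall j, `|e j 0| <= 1) ->
  norm2 (A *m u) ^+ 2 <= #|J|%:R / kap.
Proof.
move=> e1; set t := norm2 _ ^+ 2.
have uS j : j \notin S -> u j 0 = 0.
  move=> jS; apply: certificate_outside; apply: contra jS.
  exact: (fintype.subsetP JS).
have tE : t = \sum_(j in J) u j 0 * e j 0.
  rewrite /t norm2_mulmx (sum_supported _ certificate_outside).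
  by apply: eq_bigr => j jJ; rewrite certificate_coldot.
have h1 := isom uS; rewrite -/t in h1.
have h2 : \sum_(j in J) u j 0 ^+ 2 <= norm2 u ^+ 2.
  rewrite norm2_sqr [leRHS](bigID (mem J))/= lerDl; apply: sumr_ge0 => j _.
  exact: sqr_ge0.
have h3 : t <= kap / 2 * \sum_(j in J) u j 0 ^+ 2 + #|J|%:R / (2 * kap).
  have -> : #|J|%:R / (2 * kap) = \sum_(j in J) (2 * kap)^-1.
    by rewrite sumr_const mulr_natl.
  rewrite tE mulr_sumr -big_split/=; apply: ler_sum => j _.
  apply: (@le_trans _ _ `|u j 0|).
    apply: le_trans (ler_norm _) _; rewrite normrM -[leRHS]mulr1.
    by rewrite ler_wpM2l.
  rewrite -[u j 0 ^+ 2]real_normK ?num_real//; set a := `|u j 0|.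
  rewrite -subr_ge0.
  have -> : kap / 2 * a ^+ 2 + (2 * kap)^-1 - a = kap / 2 * (a - kap^-1) ^+ 2.
    by field; rewrite gt_eqF.
  by rewrite mulr_ge0 ?sqr_ge0// divr_ge0// ltW.
have h4 : kap / 2 * \sum_(j in J) u j 0 ^+ 2 <= t / 2.
  rewrite mulrAC ler_pM2r ?invr_gt0//; apply: le_trans h1.
  by rewrite ler_pM2l.
have -> : #|J|%:R / kap = 2 * (#|J|%:R / (2 * kap)) by field; rewrite gt_eqF.
lra.
Qed.

End CertificateProperties.

Lemma certificate_bound e i : (forall j, `|e j 0| <= 1) -> i \in S ->
  `|coldot A (A *m certificate A e (S :\ i)) i| <= 1 ->
  `|certificate A e S i 0| <= 2 / kap.
Proof.
move=> e1 iS wi.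
set u := certificate A e S; set u' := certificate A e (S :\ i) in wi *.
have sub : S :\ i \subset S by exact: finset.subsetDl.
have uS := @certificate_outside e S (subxx _).
have u'S := @certificate_outside e (S :\ i) sub.
pose d := u - u'.
have dE j : d j 0 = u j 0 - u' j 0 by rewrite [LHS]mxE [X in _ + X = _]mxE.
have dS j : j \notin S -> d j 0 = 0.
  move=> jS; rewrite dE uS// u'S ?subrr//.
  by apply: contra jS => /(fintype.subsetP sub).
have di : d i 0 = u i 0 by rewrite dE u'S ?subr0// !inE eqxx.
(* Only the [i]-th term survives, and it is linear in u_i, while [isom] bounds the left side below
   by kap u_i^2. *)
have nE : norm2 (A *m d) ^+ 2 = u i 0 * (e i 0 - coldot A (A *m u') i).
  rewrite norm2_mulmx (sum_supported _ dS) (big_setD1 i)//= di.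
  rewrite [X in _ + X]big1 ?addr0.
    by rewrite mulmxBr coldotB certificate_coldot.
  move=> j jS; rewrite mulmxBr coldotB !certificate_coldot// ?subrr ?mulr0//.
  exact: (fintype.subsetP sub).
have h1 := isom dS.
have h2 : u i 0 ^+ 2 <= norm2 d ^+ 2.
  rewrite norm2_sqr (bigD1 i)//= di lerDl; apply: sumr_ge0 => j _; exact: sqr_ge0.
have h3 : u i 0 * (e i 0 - coldot A (A *m u') i) <= `|u i 0| * 2.
  apply: le_trans (ler_norm _) _; rewrite normrM ler_wpM2l//.
  apply: le_trans (ler_normB _ _) _.
  by have := e1 i; lra.
have h4 : kap * `|u i 0| ^+ 2 <= `|u i 0| * 2.
  rewrite real_normK ?num_real//; apply: le_trans h3; rewrite -nE; apply: le_trans h1.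
  by rewrite ler_pM2l.
have [u0|un] := eqVneq (u i 0) 0; first by rewrite u0 normr0 divr_ge0// ltW.
have up : 0 < `|u i 0| by rewrite normr_gt0.
rewrite ler_pdivlMr// -(ler_pM2r up).
by move: h4; rewrite expr2; lra.
Qed.

End DualCertificate.

Definition sgn_col (R : realType) n (v : 'cV[R]_n) : 'cV[R]_n := \col_j Num.sg (v j 0).

Lemma coldotBl (R : realType) m n (A A' : 'M[R]_(m, n)) r j :
  coldot (A - A') r j = coldot A r j - coldot A' r j.
Proof. by rewrite /coldot -sumrB; apply: eq_bigr => i _; rewrite !mxE mulrBl. Qed.

(** * Stability of the support under perturbation of the data *)

Section Stability.
Context (R : realType) (m n : nat) (lam : R) (A : 'M[R]_(m, n)) (v : 'cV[R]_n).
Let S := supp v.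
Let e := sgn_col v.
Let N : R := n%:R.
Let B : R := 1 + norm1 v.
Hypothesis m0 : (0 < m)%N.
Hypothesis mn : (m <= n)%N.
Hypothesis S0 : (0 < #|S|)%N.
Hypothesis isom : forall x : 'cV[R]_n, (forall j, j \notin S -> x j 0 = 0) ->
  m%:R / 4 * norm2 x ^+ 2 <= norm2 (A *m x) ^+ 2.
Hypothesis dual : forall j, `|coldot A (A *m certificate A e (S :\ j)) j| <= 9 / 10.
Hypothesis AN : forall i j, `|A i j| + 1 <= N.
Hypothesis v_large : forall j, j \in S -> 8 * lam / m%:R < `|v j 0|.
Hypothesis lam_ge : 2 / N ^+ 2 <= lam.

Variables (y' : 'cV[R]_m) (A' : 'M[R]_(m, n)) (z : 'cV[R]_n) (dlt : R).
Hypothesis dlt0 : 0 <= dlt.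
Hypothesis dltB : dlt * (17 * 1000 * N ^+ 7 * B) <= 1.
Hypothesis yd : forall i, `|y' i 0 - (A *m v) i 0| <= dlt.
Hypothesis Ad : forall i j, `|A' i j - A i j| <= dlt.
Hypothesis zsol : lasso_sol lam y' A' z.

Let u := certificate A e S.
Let x0 := v - (lam / 2) *: u.
(** Tolerance in the optimality conditions. Condition [small] of [kkt_supp] becomes 16 N^2 s rho <
    1/40, whence the power N^3, as s <= N. *)
Let rho : R := (1000 * N ^+ 3)^-1.

Let mR : 0 < m%:R :> R. Proof. by rewrite ltr0n. Qed.
Let N1 : 1 <= N. Proof. by rewrite ler1n (leq_trans m0). Qed.
Let mN : m%:R <= N. Proof. by rewrite ler_nat. Qed.
Let s0 : 0 < #|S|%:R :> R. Proof. by rewrite ltr0n. Qed.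
Let sN : #|S|%:R <= N.
Proof. by rewrite ler_nat (leq_trans (max_card _)) ?card_ord. Qed.
Let N2 : 1 <= N ^+ 2. Proof. by rewrite exprn_ege1. Qed.
Let N3 : 1 <= N ^+ 3. Proof. by rewrite exprn_ege1. Qed.
Let N4 : 1 <= N ^+ 4. Proof. by rewrite exprn_ege1. Qed.
Let lam0 : 0 < lam.
Proof. by apply: lt_le_trans lam_ge; rewrite divr_gt0//; have := N2; lra. Qed.
Let B1 : 1 <= B. Proof. by rewrite lerDl sumr_ge0. Qed.
Let kap0 : 0 < m%:R / 4 :> R. Proof. by rewrite divr_gt0. Qed.
Let rho0 : 0 < rho. Proof. by rewrite invr_gt0; have := N3; lra. Qed.
Let e1 j : `|e j 0| <= 1.
Proof. by rewrite mxE normr_sg; case: eqP. Qed.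

Let dlt_rho : 17 * N ^+ 4 * (dlt * B) <= rho.
Proof.
rewrite /rho -[leRHS]mul1r ler_pdivlMr; last by have := N3; lra.
by apply: le_trans dltB; rewrite le_eqVlt; apply/orP; left; apply/eqP; ring.
Qed.

Let dlt_le : dlt <= rho.
Proof.
apply: le_trans dlt_rho; rewrite mulrCA ler_peMr//.
have := B1; have := N4; nra.
Qed.

Let rho_le1 : rho <= 1 / 1000.
Proof. by rewrite /rho -[leLHS]mul1r ler_pdivrMr; have := N3; lra. Qed.

(** The unit of slack in [AN] absorbs the perturbation. *)
Let A'N i j : `|A' i j| <= N.
Proof.
apply: le_trans (AN i j); rewrite -[A' i j](subrK (A i j)) addrC.
apply: le_trans (ler_normD _ _) _; rewrite lerD2l.
by apply: le_trans (Ad i j) _; have := dlt_le; have := rho_le1; lra.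
Qed.

Let AleN i j : `|A i j| <= N.
Proof. by have := AN i j; lra. Qed.

Let uS j : j \notin S -> u j 0 = 0.
Proof. by move=> jS; apply: (certificate_outside kap0 isom _ (subxx _)). Qed.

Let u_bound j : `|u j 0| <= 8 / m%:R.
Proof.
have [jS|/uS ->] := boolP (j \in S); last by rewrite normr0 divr_ge0// ltW.
have -> : 8 / m%:R = 2 / (m%:R / 4) :> R by field; rewrite gt_eqF.
apply: (certificate_bound kap0 isom) => //.
by apply: le_trans (dual j) _; lra.
Qed.

Let u_norm1 : \sum_j `|u j 0| <= 8 * N / m%:R.
Proof.
rewrite (sum_split_set S) [X in _ + X]big1 ?addr0; last first.
  by move=> j; rewrite inE => /uS ->; rewrite normr0.
apply: (@le_trans _ _ (\sum_(j in S) 8 / m%:R)); first exact: ler_sum.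
rewrite sumr_const -[_ *+ #|_|]mulr_natl [leRHS]mulrAC [leRHS]mulrC ler_wpM2r//.
Qed.

Let q j := 2 / lam * coldot A' (y' - A' *m x0) j.

(** The difference has a data term with factor 2 / lam <= N^2, by [lam_ge], and two terms where A' -
    A acts next to [u], whose l1 norm is at most 8 N / m. They cost 1 and 16 times N^4 dlt B, hence
    the 17 in [dltB]. *)
Let q_close j : `|q j - coldot A (A *m u) j| <= rho.
Proof.
(* This is y' - A' v, split into two small differences. *)
pose w := (y' - A *m v) - (A' - A) *m v.
have wb i : `|w i 0| <= dlt * B.
  rewrite /w [X in `|X|]mxE [X in _ + X]mxE; apply: le_trans (ler_normB _ _) _.
  rewrite mulrDr mulr1 lerD//.
    by rewrite [X in `|X|]mxE [X in _ + X]mxE.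
  by apply: normr_mulmx_le => k l; rewrite mxE [X in _ + X]mxE.
have rE : y' - A' *m x0 = w + (lam / 2) *: (A' *m u).
  rewrite /w /x0 mulmxBr -scalemxAr mulmxBl.
  move: (A *m v) (A' *m v) (A' *m u) => a b c.
  by apply/colP => i; rewrite !mxE; ring.
have qE : q j = 2 / lam * coldot A' w j + coldot A' (A' *m u) j.
  by rewrite /q rE coldotD coldotZ; field; rewrite gt_eqF.
have dE : coldot A' (A' *m u) j - coldot A (A *m u) j =
    coldot (A' - A) (A' *m u) j + coldot A ((A' - A) *m u) j.
  by rewrite mulmxBl coldotB coldotBl; ring.
have D i k : `|(A' - A) i k| <= dlt by rewrite !mxE.
have U0 : 0 <= \sum_j `|u j 0| by apply: sumr_ge0.
set U := \sum_j `|u j 0| in U0.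
have UN : U <= 8 * N / m%:R by exact: u_norm1.
have b1 : `|coldot A' w j| <= m%:R * (N * (dlt * B)) by exact: normr_coldot_le.
have b2 : `|coldot (A' - A) (A' *m u) j| <= m%:R * (dlt * (N * U)).
  by apply: normr_coldot_le => // i; exact: normr_mulmx_le.
have b3 : `|coldot A ((A' - A) *m u) j| <= m%:R * (N * (dlt * U)).
  by apply: normr_coldot_le => // i; exact: normr_mulmx_le.
have lamN : 2 / lam <= N ^+ 2.
  rewrite ler_pdivrMr//; move: lam_ge; rewrite ler_pdivrMr; last by have := N2; lra.
  by rewrite mulrC.
have mU : m%:R * U <= 8 * N by move: UN; rewrite ler_pdivlMr// mulrC.
have c1 : 2 / lam * (m%:R * (N * (dlt * B))) <= N ^+ 4 * (dlt * B).
  have p : 0 <= dlt * B by rewrite mulr_ge0//; have := B1; lra.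
  apply: (@le_trans _ _ (N ^+ 2 * (N * (N * (dlt * B))))).
    apply: ler_pM => //.
    - by rewrite divr_ge0// ltW.
    - by rewrite mulr_ge0// mulr_ge0//; have := N1; lra.
    - by apply: ler_wpM2r => //; rewrite mulr_ge0//; have := N1; lra.
  by rewrite le_eqVlt; apply/orP; left; apply/eqP; ring.
have c2 : m%:R * (dlt * (N * U)) + m%:R * (N * (dlt * U)) <= 16 * N ^+ 4 * (dlt * B).
  have -> : m%:R * (dlt * (N * U)) + m%:R * (N * (dlt * U)) = 2 * N * dlt * (m%:R * U) by ring.
  have N0 : 0 <= 2 * N * dlt by rewrite !mulr_ge0//; have := N1; lra.
  apply: (le_trans (ler_wpM2l N0 mU)).
  have -> : 2 * N * dlt * (8 * N) = 16 * N ^+ 2 * dlt by ring.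
  have -> : 16 * N ^+ 4 * (dlt * B) = 16 * N ^+ 2 * dlt * (N ^+ 2 * B) by ring.
  rewrite ler_peMr//; first by rewrite !mulr_ge0//; have := N2; lra.
  by have := N2; have := B1; nra.
rewrite qE -addrA dE; apply: le_trans dlt_rho.
apply: le_trans (ler_normD _ _) _; rewrite normrM [X in X * _]gtr0_norm ?divr_gt0//.
have c3 : 2 / lam * `|coldot A' w j| <= 2 / lam * (m%:R * (N * (dlt * B))).
  by rewrite ler_wpM2l// divr_ge0// ltW.
have c4 := ler_normD (coldot (A' - A) (A' *m u) j) (coldot A ((A' - A) *m u) j).
lra.
Qed.

(** Let H be the l1 norm of h on S. On the cone the rest of h has l1 norm at most 20 rho H, so b =
    A' h and a = A hS differ by at most eps H in each entry. From b^2 >= a^2 / 2 - (b - a)^2, the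
    constant m/4 and Cauchy-Schwarz, the coefficient of H^2 is at least m/(8s) - m/(16s). *)
Let curv (h : 'cV[R]_n) : 1 / 20 * \sum_(j in ~: S) `|h j 0| <= rho * \sum_(j in S) `|h j 0| ->
  m%:R / (16 * #|S|%:R) * (\sum_(j in S) `|h j 0|) ^+ 2 <= norm2 (A' *m h) ^+ 2.
Proof.
have Hc0 : 0 <= \sum_(j in ~: S) `|h j 0| by exact: sumr_ge0.
have H0 : 0 <= \sum_(j in S) `|h j 0| by exact: sumr_ge0.
set Hc := \sum_(j in ~: S) `|h j 0| in Hc0 *; set H := \sum_(j in S) `|h j 0| in H0 *.
move=> cone.
pose hS := mask_col S h; pose hC : 'cV[R]_n := mask_col (~: S) h.
have hE : h = hS + hC.
  by apply/colP => j; rewrite !mxE finset.in_setC; case: (j \in S); rewrite ?addr0 ?add0r.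
have hS1 : \sum_j `|hS j 0| = H.
  rewrite (sum_split_set S) [X in _ + X]big1 ?addr0.
    by apply: eq_bigr => j jS; rewrite mxE jS.
  by move=> j; rewrite finset.in_setC => jS; rewrite mxE (negbTE jS) normr0.
have hC1 : \sum_j `|hC j 0| = Hc.
  rewrite (sum_split_set S) [X in X + _]big1 ?add0r.
    by apply: eq_bigr => j; rewrite finset.in_setC => jS; rewrite mxE finset.in_setC jS.
  by move=> j jS; rewrite mxE finset.in_setC jS normr0.
pose eps := dlt + 20 * N * rho.
have g i : `|(A' *m h) i 0 - (A *m hS) i 0| <= eps * H.
  have -> : (A' *m h) i 0 - (A *m hS) i 0 = ((A' - A) *m hS) i 0 + (A' *m hC) i 0.
    rewrite {1}hE mulmxDr mulmxBl.
    move: (A' *m hS) (A *m hS) (A' *m hC) => a b c.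
    by rewrite !mxE; ring.
  apply: le_trans (ler_normD _ _) _; rewrite mulrDl lerD//.
    by rewrite -hS1; apply: normr_mulmx_le => k l; rewrite !mxE.
  apply: le_trans (normr_mulmx_le _ _ A'N) _; rewrite hC1.
  have -> : 20 * N * rho * H = N * (20 * (rho * H)) by ring.
  by rewrite ler_wpM2l//; have := N1; lra.
have low : norm2 (A *m hS) ^+ 2 / 2 - m%:R * (eps * H) ^+ 2 <= norm2 (A' *m h) ^+ 2.
  rewrite !norm2_sqr mulr_suml -[X in X%:R * _]card_ord mulr_natl -sumr_const -sumrB.
  apply: ler_sum => i _.
  have : ((A' *m h) i 0 - (A *m hS) i 0) ^+ 2 <= (eps * H) ^+ 2.
    by rewrite -[leLHS]real_normK ?num_real// lerXn2r ?nnegrE// (le_trans _ (g i)).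
  set a := (A *m hS) i 0; set b := (A' *m h) i 0 => ab.
  have := sqr_ge0 (2 * b - a); nra.
have iso := isom (x := hS).
have hSn : norm2 hS ^+ 2 = \sum_(j in S) `|h j 0| ^+ 2.
  rewrite norm2_sqr (sum_split_set S) [X in _ + X]big1 ?addr0.
    by apply: eq_bigr => j jS; rewrite mxE jS real_normK ?num_real.
  by move=> j; rewrite finset.in_setC => jS; rewrite mxE (negbTE jS) expr0n.
have CS := sqr_sum_le_card S (fun j => `|h j 0|).
rewrite -hSn -/H in CS.
have iso1 : m%:R / 4 * norm2 hS ^+ 2 <= norm2 (A *m hS) ^+ 2.
  by apply: iso => j jS; rewrite mxE (negbTE jS).
have iso2 : m%:R / (4 * #|S|%:R) * H ^+ 2 <= m%:R / 4 * norm2 hS ^+ 2.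
  have -> : m%:R / (4 * #|S|%:R) * H ^+ 2 = m%:R / 4 * (H ^+ 2 / #|S|%:R) :> R.
    by field; rewrite gt_eqF.
  by rewrite ler_pM2l// ler_pdivrMr// mulrC.
have epsS : eps ^+ 2 <= 1 / (16 * #|S|%:R).
  have eN : eps <= 1 / 40.
    have : N * rho <= 1 / 1000.
      rewrite /rho ler_pdivrMr; last by have := N3; lra.
      have -> : 1 / 1000 * (1000 * N ^+ 3) = N * N ^+ 2 by field.
      by rewrite ler_peMr//; have := N1; lra.
    by rewrite /eps; have := dlt_le; have := rho_le1; lra.
  have eN2 : eps * N <= 1 / 40.
    have : N ^+ 2 * rho <= 1 / 1000.
      rewrite /rho ler_pdivrMr; last by have := N3; lra.
      have -> : 1 / 1000 * (1000 * N ^+ 3) = N ^+ 2 * N by field.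
      by rewrite ler_peMr//; have := N2; lra.
    have : dlt * N <= N ^+ 2 * rho.
      rewrite mulrC expr2 -mulrA ler_pM2l; last by have := N1; lra.
      apply: (le_trans dlt_le); rewrite ler_peMl// ltW//.
    rewrite /eps mulrDl; have -> : 20 * N * rho * N = 20 * (N ^+ 2 * rho) by ring.
    lra.
  have e0 : 0 <= eps.
    by rewrite /eps addr_ge0// !mulr_ge0// ?ltW//; have := N1; lra.
  rewrite ler_pdivlMr; last by rewrite mulr_gt0.
  have : eps ^+ 2 * #|S|%:R <= eps * (eps * N).
    by rewrite expr2 -mulrA ler_wpM2l// ler_wpM2l.
  have : eps * (eps * N) <= 1 / 40 * (1 / 40).
    by apply: ler_pM => //; rewrite mulr_ge0//; have := N1; lra.
  lra.
apply: le_trans low.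
have -> : m%:R / (16 * #|S|%:R) * H ^+ 2 =
    (m%:R / (4 * #|S|%:R) * H ^+ 2) / 2 - m%:R * (1 / (16 * #|S|%:R) * H ^+ 2).
  by field; rewrite gt_eqF.
apply: lerB; first by rewrite ler_pM2r ?invr_gt0// (le_trans iso2).
by rewrite ler_pM2l// exprMn ler_wpM2r// sqr_ge0.
Qed.

Lemma lasso_supp_stable : supp z = S.
Proof.
have x0E j : x0 j 0 = v j 0 - lam / 2 * u j 0.
  by rewrite [LHS]mxE [X in _ + X = _]mxE [X in - X]mxE.
have lu j : lam / 2 * `|u j 0| <= 4 * lam / m%:R.
  have -> : 4 * lam / m%:R = lam / 2 * (8 / m%:R) by field; rewrite gt_eqF.
  by rewrite ler_wpM2l// divr_ge0// ltW.
(* The shift (lam/2) u consumes at most half of the lower bound [v_large], so [x0] keeps the signs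
   of [v]. *)
have ex j : j \in S -> 4 * lam / m%:R <= e j 0 * x0 j 0.
  move=> jS; rewrite x0E mulrBr.
  have h1 : e j 0 * v j 0 = `|v j 0| by rewrite mxE -normrEsg.
  have h2 : e j 0 * (lam / 2 * u j 0) <= 4 * lam / m%:R.
    apply: le_trans (lu j); apply: le_trans (ler_norm _) _.
    by rewrite normrM normrM [`|lam / 2|]gtr0_norm ?divr_gt0// ler_piMl// mulr_ge0// divr_ge0// ltW.
  have h3 := v_large jS; rewrite h1.
  have h4 : 4 * lam / m%:R = 8 * lam / m%:R / 2 by field; rewrite gt_eqF.
  lra.
have rhoN : 16 * #|S|%:R * rho <= 16 / 1000.
  have : #|S|%:R * rho <= N * rho by rewrite ler_wpM2r// ltW.
  have : N * rho <= 1 / 1000.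
    rewrite /rho ler_pdivrMr; last by have := N3; lra.
    have -> : 1 / 1000 * (1000 * N ^+ 3) = N * N ^+ 2 by field.
    by rewrite ler_peMr//; have := N1; lra.
  lra.
have gamE : lam * rho / (m%:R / (16 * #|S|%:R)) = lam / m%:R * (16 * #|S|%:R * rho).
  by field; rewrite !gt_eqF.
(* The dual margin 1/20 is half of the 1/10 left by [dual]; the other half covers [rho]. *)
apply: (@kkt_supp _ _ _ lam y' A' S x0 z q (fun j => e j 0) rho (1 / 20)
  (m%:R / (16 * #|S|%:R)) N) => //.
- exact: ltW.
- by rewrite divr_gt0// mulr_gt0.
- by move=> j jS; rewrite x0E uS// supp_outside// mulr0 subr0.
- move=> j jS; have h : 0 < e j 0 * x0 j 0.
    by apply: lt_le_trans (ex j jS); rewrite divr_gt0// mulr_gt0.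
  rewrite -(gtr0_norm h) normrM mxE normr_sg; move: jS; rewrite inE => ->.
  by rewrite mul1r.
- by move=> j; rewrite /q; field; rewrite gt_eqF.
- move=> j jS; rewrite -(certificate_coldot kap0 isom e (subxx _) jS); exact: q_close.
(* Outside [S] nothing is left out, and [dual] is a statement about [u] itself. *)
- move=> j jS; have := dual j; rewrite (_ : S :\ j = S); last first.
    by apply/finset.setDidPl; rewrite disjoint_sym disjoints1.
  rewrite -/u => dj; have := q_close j => qj.
  rewrite -[q j](subrK (coldot A (A *m u) j)).
  apply: le_trans (ler_normD _ _) _; have := rho_le1; lra.
- move=> j jS; apply: (@lt_le_trans _ _ (4 * lam / m%:R)); last first.
    apply: (le_trans (ex j jS)); apply: le_trans (ler_norm _) _.
    by rewrite normrM -[leRHS]mul1r ler_wpM2r.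
  rewrite gamE (_ : 4 * lam / m%:R = lam / m%:R * 4); last by ring.
  by rewrite ltr_pM2l ?divr_gt0//; lra.
- rewrite gamE.
  have -> : m%:R * N ^+ 2 * (lam / m%:R * (16 * #|S|%:R * rho)) =
      lam * (16 * (N ^+ 2 * (#|S|%:R * rho))) by field; rewrite gt_eqF.
  have : N ^+ 2 * (#|S|%:R * rho) <= 1 / 1000.
    apply: (@le_trans _ _ (N ^+ 2 * (N * rho))).
      by rewrite ler_wpM2l ?sqr_ge0// ler_wpM2r// ltW.
    rewrite /rho le_eqVlt; apply/orP; left; apply/eqP; field.
    by rewrite gt_eqF//; have := N1; lra.
  move=> h; have -> : lam * (1 / 20) / 2 = lam * (1 / 40) by field.
  by rewrite ltr_pM2l//; lra.
Qed.

End Stability.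

Lemma ler_mx_norm (R : realType) m n (M : 'M[R]_(m, n)) i j : `|M i j| <= mx_norm M.
Proof.
rewrite mx_normE -[leLHS]nngE num_le.
exact: (le_bigmax _ (fun k => `|M k.1 k.2|%:nng) (i, j)).
Qed.

Lemma mx_norm_ler (R : realType) m n (M : 'M[R]_(m, n)) c : 0 <= c ->
  (forall i j, `|M i j| <= c) -> mx_norm M <= c.
Proof.
move=> c0 Mc; rewrite mx_normE -[leRHS](_ : (NngNum c0)%:num = c)// num_le.
by apply/bigmax_leP; split => // -[i j] _; rewrite -num_le/=.
Qed.

(** * From stability to the condition number *)

Section ConditionNumber.
Context (R : realType) (lam : R) (m n : nat) (y : 'cV[R]_m) (A : 'M[R]_(m, n)).
Context (S : {set 'I_n}) (d0 : R).
Hypothesis d00 : 0 < d0.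
Hypothesis stable : forall (y' : 'cV[R]_m) (A' : 'M[R]_(m, n)) (z : 'cV[R]_n),
  (forall i, `|y' i 0 - y i 0| <= d0) -> (forall i j, `|A' i j - A i j| <= d0) ->
  lasso_sol lam y' A' z -> supp z = S.

Lemma lasso_supp_unique T : lasso_supp lam y A T -> T = S.
Proof.
move=> [x solx <-]; apply: (stable _ _ solx) => [i|i j];
  by rewrite subrr normr0 ltW.
Qed.

Lemma stsp_ge : (d0%:E <= stsp lam y A)%E.
Proof.
apply: le_ereal_inf_tmp => _ [dl [dl0 [y' [A' [x [x' [sx sx' yy AA ne]]]]]] <-].
rewrite lee_fin leNgt; apply/negP => dd0; apply: ne.
rewrite (@lasso_supp_unique (supp x)); last by exists x.
apply/esym; apply: (stable _ _ sx') => [i|i j].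
  have := ler_mx_norm (y' - y) i 0; rewrite [X in `|X|]mxE [X in _ + X]mxE => h.
  by apply: le_trans h _; apply: le_trans yy _; exact: ltW.
have := ler_mx_norm (A' - A) i j; rewrite [X in `|X|]mxE [X in _ + X]mxE => h.
by apply: le_trans h _; apply: le_trans AA _; exact: ltW.
Qed.

Lemma condUL_lty : (condUL lam y A < +oo)%E /\ fine (condUL lam y A) <= d0^-1.
Proof.
have := stsp_ge; rewrite /condUL; case: (stsp lam y A) => [r| |].
- rewrite lee_fin => rd; have r0 : 0 < r by exact: lt_le_trans rd.
  rewrite eqe gt_eqF// inver gt_eqF// ltry/=; split => //.
  by rewrite lef_pV2.
(* If no perturbation changes the support, [stsp] is [+oo] and its inverse is 0. *)
- move=> _ /=; rewrite invey ltry/=; split => //.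
  by rewrite invr_ge0 ltW.
- by rewrite leeNy_eq.
Qed.

End ConditionNumber.

(** * The random matrix *)

Section Net.
Context (R : realType) (m n : nat).

(* The index [k = K] is the origin. *)
Definition grid (K : nat) (k : {ffun 'I_n -> 'I_(K.*2.+1)}) (j : 'I_n) : R :=
  (k j)%:R / K%:R - 1.

(** With [inord K] as default index the points vanish outside [S], so their number is exponential in
    |S| only. *)
Definition grid_set (K : nat) (S : {set 'I_n}) : pred {ffun 'I_n -> 'I_(K.*2.+1)} :=
  pffun_on (inord K) (mem S) predT.

Arguments grid_set : clear implicits.

Lemma card_grid_set K S : #|grid_set K S| = (K.*2.+1 ^ #|S|)%N.
Proof. by rewrite card_pffun_on card_ord. Qed.

Lemma grid_approx K (S : {set 'I_n}) (x : 'I_n -> R) : (0 < K)%N ->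
  (forall j, `|x j| <= 1) -> (forall j, j \notin S -> x j = 0) ->
  exists2 k, k \in grid_set K S &
    (forall j, `|x j - grid k j| <= K%:R^-1) /\
    (forall j, j \notin S -> grid k j = 0).
Proof.
move=> K0 x1 xS.
have KR : 0 < K%:R :> R by rewrite ltr0n.
(* The rescaled coordinate lies in [0, 2K], hence the 2K + 1 values. *)
pose t j := Num.truncn (K%:R * (x j + 1)).
have t0 j : 0 <= K%:R * (x j + 1).
  by rewrite mulr_ge0//; have := x1 j; rewrite ler_norml; lra.
have tlt j : (t j < K.*2.+1)%N.
  rewrite ltnS -(ler_nat R); apply: (@le_trans _ _ (K%:R * (x j + 1))).
    by have /andP[] := truncn_itv (t0 j).
  rewrite -muln2 natrM ler_pM2l//; have := x1 j; rewrite ler_norml; lra.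
pose k := [ffun j => if j \in S then Ordinal (tlt j) else inord K].
have kS j : j \notin S -> grid k j = 0.
  move=> jS; rewrite /grid ffunE (negbTE jS) inordK ?ltnS -?addnn ?leq_addr//.
  by rewrite divff ?subrr// gt_eqF.
exists k.
  apply/pffun_onP; split => //; apply/fintype.subsetP => j; rewrite unfold_in/= ffunE.
  by case: ifP => // _; rewrite eqxx.
split => // j; have [jS|jS] := boolP (j \in S); last first.
  by rewrite kS// xS// subrr normr0 invr_ge0 ltW.
rewrite /grid ffunE jS/=; have /andP[a b] := truncn_itv (t0 j).
have -> : x j - ((t j)%:R / K%:R - 1) = (K%:R * (x j + 1) - (t j)%:R) / K%:R.
  by field; rewrite gt_eqF.
rewrite ger0_norm; last by rewrite divr_ge0 ?subr_ge0// ltW.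
rewrite -[leRHS]mul1r ler_pM2r ?invr_gt0//.
by move: b; rewrite -/(t j) -natr1; lra.
Qed.

Variables (A : 'M[R]_(m, n)) (S : {set 'I_n}) (L : R) (K : nat).
Hypothesis L1 : 1 <= L.
Hypothesis AL : forall i j, `|A i j| <= L.
Hypothesis KL : 25 * #|S|%:R * L <= K%:R.
Hypothesis S0 : (0 < #|S|)%N.
Hypothesis net : forall k, k \in grid_set K S ->
  m%:R / 3 * \sum_j grid k j ^+ 2 <= \sum_i (\sum_j grid k j * A i j) ^+ 2.

Let s1 : 1 <= #|S|%:R :> R. Proof. by rewrite ler1n. Qed.

(** For the nearby grid point g, each entry of A (x - g) is at most s L / K <= 1/25, so its square
    norm is at most m/625: the mesh compensates for the crude entry bound [L]. *)
Lemma isom_of_net_unit (x : 'cV[R]_n) : (forall j, j \notin S -> x j 0 = 0) ->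
  norm2 x ^+ 2 = 1 -> m%:R / 4 <= norm2 (A *m x) ^+ 2.
Proof.
rewrite !norm2_sqr => xS x1.
have s0 : 0 < #|S|%:R :> R by have := s1; lra.
have sL : 25 <= 25 * #|S|%:R * L by have := s1; have := L1; nra.
have KR : 25 <= K%:R :> R by apply: le_trans sL KL.
have Kp : 0 < K%:R :> R by lra.
have K0 : (0 < K)%N by rewrite -(ltr0n R).
have xb j : `|x j 0| <= 1.
  rewrite -(@expr_le1 _ 2)// real_normK ?num_real// -x1 (bigD1 j)//= lerDl.
  by apply: sumr_ge0 => i _; exact: sqr_ge0.
have [k kn [kd kS]] := grid_approx K0 xb xS.
have netk := net kn.
pose dd j := x j 0 - grid k j.
have ddS j : j \notin S -> dd j = 0 by move=> jS; rewrite /dd xS// kS// subrr.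
have sK : #|S|%:R * L / K%:R <= 1 / 25 by rewrite ler_pdivrMr//; have := KL; lra.
have sK1 : #|S|%:R / K%:R <= 1 / 25 :> R.
  apply: (le_trans _ sK); rewrite ler_pM2r ?invr_gt0// ler_peMr//; exact: ltW.
have Kinv : K%:R^-1 <= 1 / 25 :> R by rewrite -[leLHS]mul1r ler_pdivrMr//; lra.
have Ki0 : 0 < K%:R^-1 :> R by rewrite invr_gt0.
have d2 : \sum_j dd j ^+ 2 <= 1 / 625.
  rewrite (sum_split_set S) [X in _ + X]big1 ?addr0; last first.
    by move=> j; rewrite finset.in_setC => /ddS ->; rewrite expr0n.
  apply: (@le_trans _ _ (\sum_(j in S) K%:R^-1 ^+ 2)).
    apply: ler_sum => j _; rewrite -[leLHS]real_normK ?num_real//.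
    by rewrite lerXn2r ?nnegrE ?kd// ltW.
  rewrite sumr_const -[_ *+ #|_|]mulr_natl expr2 mulrA.
  have : #|S|%:R / K%:R * K%:R^-1 <= 1 / 25 * (1 / 25) :> R.
    by apply: ler_pM => //; apply: ltW; rewrite ?divr_gt0.
  lra.
have Ad i : `|\sum_j dd j * A i j| <= 1 / 25.
  rewrite (sum_split_set S) [X in _ + X]big1 ?addr0; last first.
    by move=> j; rewrite finset.in_setC => /ddS ->; rewrite mul0r.
  apply: le_trans (ler_norm_sum _ _ _) _.
  apply: (@le_trans _ _ (\sum_(j in S) K%:R^-1 * L)).
    by apply: ler_sum => j _; rewrite normrM; apply: ler_pM => //; exact: kd.
  rewrite sumr_const -[_ *+ #|_|]mulr_natl.
  by apply: (le_trans _ sK); rewrite mulrA mulrAC.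
have Ad2 : \sum_i (\sum_j dd j * A i j) ^+ 2 <= m%:R / 625.
  have -> : m%:R / 625 = \sum_(i < m) (1 / 25) ^+ 2 :> R.
    by rewrite sumr_const card_ord -[RHS]mulr_natl; field.
  apply: ler_sum => i _; rewrite -[leLHS]real_normK ?num_real//.
  by rewrite lerXn2r ?nnegrE ?Ad// divr_ge0.
(* The factor 10/9 is close enough to 1: with 8856/10000 = (9/10)(1 - 10/625), the constant becomes
   (9/10)(8856/30000 - 10/625), just above 1/4. *)
have split2 (a b : R) : (a + b) ^+ 2 <= 10 / 9 * a ^+ 2 + 10 * b ^+ 2.
  by have := sqr_ge0 (a / 3 - 3 * b); nra.
set G := \sum_j grid k j ^+ 2 in netk.
set AG := \sum_i (\sum_j grid k j * A i j) ^+ 2 in netk.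
have h1 : 1 <= 10 / 9 * G + 10 * \sum_j dd j ^+ 2.
  rewrite -[leLHS]x1 /G !mulr_sumr -big_split/=; apply: ler_sum => j _.
  have -> : x j 0 = grid k j + dd j by rewrite /dd addrC subrK.
  exact: split2.
have h2 : AG <= 10 / 9 * (\sum_i (A *m x) i 0 ^+ 2) + 10 * \sum_i (\sum_j dd j * A i j) ^+ 2.
  rewrite /AG !mulr_sumr -big_split/=; apply: ler_sum => i _.
  have -> : \sum_j grid k j * A i j = (A *m x) i 0 + - \sum_j dd j * A i j.
    by rewrite mxE -sumrB; apply: eq_bigr => j _; rewrite /dd; ring.
  by apply: le_trans (split2 _ _) _; rewrite sqrrN.
have m0 : 0 <= m%:R :> R by [].
have h3 : 8856 / 10000 <= G by lra.
have h4 : m%:R / 3 * (8856 / 10000) <= m%:R / 3 * G by rewrite ler_wpM2l// divr_ge0.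
lra.
Qed.

Lemma isom_of_net (x : 'cV[R]_n) : (forall j, j \notin S -> x j 0 = 0) ->
  m%:R / 4 * norm2 x ^+ 2 <= norm2 (A *m x) ^+ 2.
Proof.
move=> xS; have [x0|xn] := eqVneq (norm2 x) 0.
  by rewrite x0 expr0n mulr0 sqr_ge0.
have xp : 0 < norm2 x by rewrite lt_def xn sqrtr_ge0.
pose c := (norm2 x)^-1.
have nZ p (w : 'cV[R]_p) : norm2 (c *: w) ^+ 2 = c ^+ 2 * norm2 w ^+ 2.
  by rewrite !norm2_sqr mulr_sumr; apply: eq_bigr => j _; rewrite mxE exprMn.
have cS j : j \notin S -> (c *: x) j 0 = 0 by move=> jS; rewrite mxE xS// mulr0.
have c1 : norm2 (c *: x) ^+ 2 = 1 by rewrite nZ -exprMn /c mulVf ?expr1n.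
have := isom_of_net_unit cS c1; rewrite -scalemxAr nZ.
by rewrite /c exprVn [leRHS]mulrC ler_pdivlMr// exprn_gt0.
Qed.

End Net.

(** * Measurability of the certificate *)

Section MatrixMeasurability.
Context d (T : measurableType d) (R : realType).

(** Writing 1/f as f times the power -1 of f^2 reduces to a nonnegative base; both sides are 0 where
    f vanishes. *)
Lemma measurable_funVr (f : T -> R) : measurable_fun setT f ->
  measurable_fun setT (fun w => (f w)^-1).
Proof.
move=> mf; rewrite (_ : (fun w => _) = (fun w => f w * (f w ^+ 2) `^ (-1))).
  apply: measurable_funM => //.
  apply: (measurableT_comp (measurable_powR (-1))).
  exact: measurable_funX.
apply/funext => w; rewrite powR_inv1 ?sqr_ge0//.
have [->|fw] := eqVneq (f w) 0; first by rewrite invr0 mul0r.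
by rewrite expr2 invfM mulrA mulfV// mul1r.
Qed.

Lemma measurable_det n (M : T -> 'M[R]_n) :
  (forall i j, measurable_fun setT (fun w => M w i j)) ->
  measurable_fun setT (fun w => \det (M w)).
Proof.
move=> mM; apply: measurable_sum => s; apply: measurable_funM => //.
by apply: measurable_prod => i _; exact: mM.
Qed.

Lemma measurable_adj n (M : T -> 'M[R]_n) i j :
  (forall i j, measurable_fun setT (fun w => M w i j)) ->
  measurable_fun setT (fun w => (\adj (M w)) i j).
Proof.
move=> mM; under eq_fun do rewrite mxE.
apply: measurable_funM => //; apply: measurable_det => k l.
by under eq_fun do rewrite !mxE; exact: mM.
Qed.

(** The hypothesis concerns the columns in [J] alone, so that the certificate on [S :\ j] is
    measurable with respect to the columns other than [j]. *)
Lemma measurable_certificate m n (A : T -> 'M[R]_(m, n)) e (J : {set 'I_n}) l :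
  (forall i j, j \in J -> measurable_fun setT (fun w => A w i j)) ->
  measurable_fun setT (fun w => certificate (A w) e J l 0).
Proof.
move=> mA.
have mG i j : measurable_fun setT (fun w => gram (A w) J i j).
  under eq_fun do rewrite mxE.
  have [/andP[iJ jJ]|_] := boolP ((i \in J) && (j \in J)); last exact: measurable_cst.
  apply: measurable_sum => k; apply: measurable_funM; exact: mA.
under eq_fun do rewrite mxE; apply: measurable_funM.
  by apply: measurable_funVr; exact: measurable_det.
under eq_fun do rewrite mxE; apply: measurable_sum => k; apply: measurable_funM => //.
exact: measurable_adj.
Qed.

End MatrixMeasurability.

Lemma union_bound d (T : measurableType d) (R : realType) (P : probability T R)
    (I : choiceType) (r : seq I) (F : I -> set T) (c : R) :
  (forall i, i \in r -> measurable (F i) /\ (P (F i) <= c%:E)%E) ->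
  let E := \bigcup_(i in [set` r]) F i in
  measurable E /\ (P E <= ((size r)%:R * c)%:E)%E.
Proof.
rewrite /= bigcup_seq; elim: r => [|i r ih] H.
  by rewrite big_nil measure0 mul0r.
have [mFi Pi] := H i (mem_head _ _).
have [mr Pr] := ih (fun j jr => H j (mem_behead (s := i :: r) jr)).
rewrite big_cons; split; first exact: measurableU.
rewrite /= -natr1 mulrDl mul1r addrC EFinD; apply: le_trans (leeD Pi Pr).
exact: measureU2.
Qed.

(** * The good event and its probability *)

Section GoodEvent.
Context d (T : measurableType d) (R : realType) (P : probability T R) (m n : nat).
Context (X : 'I_m * 'I_n -> {RV P >-> R}) (v : 'cV[R]_n).
Hypothesis iidX : iid_std_gaussian X.
Let S := supp v.
Let e := sgn_col v.
Let ell : R := ln n%:R.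
Let U := random_mx X.
Hypothesis S0 : (0 < #|S|)%N.
Hypothesis ell6 : 6 <= ell.
Hypothesis msl : 11 * #|S|%:R * ell <= m%:R.
Hypothesis mn9 : m%:R <= n%:R / 9 :> R.

Notation sigmaT J := (g_sigma_algebraType (rect_sets X J)).

Let n0 : (0 < n)%N.
Proof. by rewrite lt0n; apply: contraTneq ell6 => n0; rewrite /ell n0 ln0// -ltNge. Qed.
Let nR : 0 < n%:R :> R. Proof. by rewrite ltr0n. Qed.
Let s1 : 1 <= #|S|%:R :> R. Proof. by rewrite ler1n. Qed.
Let nE : n%:R = expR ell :> R. Proof. by rewrite lnK. Qed.

(* Fine enough for [isom_of_net] when the entries are at most [ell], yet [msl]
   and [mn9] leave at most [n] grid values per coordinate. *)
Let K := (Num.truncn (25 * #|S|%:R * ell)).+1.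

Let K_ge : 25 * #|S|%:R * ell <= K%:R.
Proof.
have h : 0 <= 25 * #|S|%:R * ell by rewrite mulr_ge0//; have := ell6; lra.
by have /andP[_ /ltW] := truncn_itv h.
Qed.

Let K_le : (K.*2.+1 <= n)%N.
Proof.
have h : 0 <= 25 * #|S|%:R * ell by rewrite mulr_ge0//; have := ell6; lra.
have /andP[h1 _] := truncn_itv h.
rewrite -(ler_nat R) -natr1 -mul2n natrM /K -natr1.
have := msl; have := mn9; have := s1; have := ell6.
set sl := 25 * #|S|%:R * ell in h h1 *.
have -> : 11 * #|S|%:R * ell = 11 / 25 * sl by rewrite /sl; field.
have : 25 * 6 <= sl by rewrite /sl; have := s1; have := ell6; nra.
lra.
Qed.

Let badnet (k : {ffun 'I_n -> 'I_(K.*2.+1)}) : set T :=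
  [set w | \sum_i (\sum_j grid R k j * X (i, j) w) ^+ 2 <
           m%:R / 3 * \sum_j grid R k j ^+ 2].

(** The exponent is s ell - m/6 <= - (5/6) s ell, by [msl]. *)
Let badnetP : let E := \bigcup_(k in [set` enum (@grid_set n K S)]) badnet k in
  measurable E /\ (P E <= (expR (- ell / 10))%:E)%E.
Proof.
have ixI : injective (fun z : 'I_m * 'I_n => (z.1, z.2)) by move=> [? ?] [? ?].
have H k : k \in enum (@grid_set n K S) ->
    measurable (badnet k) /\ (P (badnet k) <= (expR (- (m%:R / 6)))%:E)%E.
  move=> _; have := @chi2_lower_tail _ _ _ _ _ X iidX 'I_m 'I_n _ (grid R k) ixI.
  by rewrite card_ord.
have [mE PE] := union_bound H; split => //; apply: le_trans PE _.
rewrite lee_fin -cardE card_grid_set.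
have h : (K.*2.+1 ^ #|S|)%:R <= expR (#|S|%:R * ell).
  by rewrite expRM_natl -nE -natrX ler_nat leq_exp2r.
apply: (@le_trans _ _ (expR (#|S|%:R * ell) * expR (- (m%:R / 6)))).
  by rewrite ler_wpM2r// expR_ge0.
rewrite -expRD ler_expR; have := msl; have := s1; have := ell6 => l6 s1' ms.
have : ell <= #|S|%:R * ell by rewrite ler_peMl//; lra.
have : 11 * #|S|%:R * ell = 11 * (#|S|%:R * ell) by ring.
lra.
Qed.

(** Restricting the product to [S :\ j] keeps its dependence on these columns visible. *)
Let wvec (j : 'I_n) (w : T) (i : 'I_m) : R :=
  \sum_(l in S :\ j) U w i l * certificate (U w) e (S :\ j) l 0.

(** The norm constraint is the one [linear_tail] asks of random weights; where the isometry holds it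
    is automatic, by [certificate_image_norm]. *)
Let baddual (j : 'I_n) : set T :=
  [set w | 9 / 10 < `|\sum_(k <- [seq (i, j) | i <- enum 'I_m]) wvec j w k.1 * X k w| /\
     \sum_(k <- [seq (i, j) | i <- enum 'I_m]) wvec j w k.1 ^+ 2 <=
       #|S|%:R / (m%:R / 4)].

Let m0 : 0 < m%:R :> R.
Proof. by apply: lt_le_trans msl; have := s1; have := ell6; nra. Qed.

(** The Gaussian exponent is (81/800) m/s >= (891/800) ell, at least (11/10) ell. The n = e^ell
    columns use up ell and leave ell/10, the final rate. *)
Let baddualP : let E := \bigcup_(j in [set` enum 'I_n]) baddual j in
  measurable E /\ (P E <= (2 * expR (- ell / 10))%:E)%E.
Proof.
have H j : j \in enum 'I_n -> measurable (baddual j) /\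
    (P (baddual j) <= (2 * expR (- (11 / 10 * ell)))%:E)%E.
  move=> _; pose J := [set k : 'I_m * 'I_n | k.2 != j]%SET.
  have ur : uniq [seq (i, j) | i <- enum 'I_m].
    by rewrite map_inj_uniq ?enum_uniq// => a b [].
  have rJ : {in [seq (i, j) | i <- enum 'I_m], forall k, k \notin J}.
    by move=> _ /mapP[i _ ->]; rewrite inE/= eqxx.
  have s20 : 0 < #|S|%:R / (m%:R / 4) :> R by rewrite divr_gt0// ?divr_gt0//; have := s1; lra.
  have a0 : 0 < 9 / 10 :> R by lra.
  have mU i l : l \in S :\ j -> measurable_fun [set: sigmaT J] (fun w => U w i l).
    move=> lS; under eq_fun do rewrite mxE; apply: measurable_X_sigmaT.
    by move: lS; rewrite !inE => /andP[].
  have mw (k : 'I_m * 'I_n) : measurable_fun [set: sigmaT J] (fun w => wvec j w k.1).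
    under eq_fun do rewrite /wvec -big_enum.
    apply: measurable_sum_seq => l; rewrite mem_enum => lS; apply: measurable_funM.
      exact: mU.
    by apply: measurable_certificate.
  have [mB PB] := linear_tail iidX ur rJ s20 a0 (c := fun k w => wvec j w k.1) mw.
  split => //; apply: le_trans PB _; rewrite lee_fin ler_pM2l// ler_expR lerN2.
  have -> : (9 / 10) ^+ 2 / (2 * (#|S|%:R / (m%:R / 4))) = 81 / 800 * (m%:R / #|S|%:R) :> R.
    by field; rewrite !gt_eqF//; have := s1; lra.
  have : 11 * ell <= m%:R / #|S|%:R.
    by rewrite ler_pdivlMr; [have := msl; lra|have := s1; lra].
  have := ell6; lra.
have [mE PE] := union_bound H; split => //; apply: le_trans PE _.
rewrite lee_fin size_enum_ord mulrCA ler_pM2l// nE -expRD ler_expR.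
by lra.
Qed.

Let badmax (z : 'I_m * 'I_n) : set T :=
  [set w | ell < `|\sum_(k <- [:: z]) 1 * X k w| /\ \sum_(k <- [:: z]) 1 ^+ 2 <= 1 :> R].

(** Since ell >= 6, the exponent ell^2 / 2 is at least 3 ell, against at most e^(2 ell) entries. *)
Let badmaxP : let E := \bigcup_(z in [set` enum {: 'I_m * 'I_n}]) badmax z in
  measurable E /\ (P E <= (2 * expR (- ell / 10))%:E)%E.
Proof.
have l0 : 0 < ell by have := ell6; lra.
have H z : z \in enum {: 'I_m * 'I_n} -> measurable (badmax z) /\
    (P (badmax z) <= (2 * expR (- (3 * ell)))%:E)%E.
  move=> _; pose J0 : {set 'I_m * 'I_n} := finset.set0.
  have rJ : {in [:: z], forall k, k \notin J0} by move=> k _; rewrite inE.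
  have mc (k : 'I_m * 'I_n) : measurable_fun [set: sigmaT J0] (fun w => 1 : R).
    exact: measurable_cst.
  have [mB PB] := linear_tail iidX (erefl : uniq [:: z]) rJ ltr01 l0
    (c := fun _ _ => 1) mc.
  split => //; apply: le_trans PB _; rewrite lee_fin ler_pM2l// ler_expR lerN2.
  by rewrite mulr1; have := ell6; nra.
have [mE PE] := union_bound H; split => //; apply: le_trans PE _.
rewrite lee_fin -cardE card_prod !card_ord mulrCA ler_pM2l//.
have : (m * n)%:R <= expR (2 * ell).
  rewrite natrM expRM_natl -nE expr2 ler_pM2r//; have := mn9; have := nR; lra.
move=> h; apply: (@le_trans _ _ (expR (2 * ell) * expR (- (3 * ell)))).
  by rewrite ler_wpM2r// expR_ge0.
by rewrite -expRD ler_expR; have := l0; lra.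
Qed.

(** The factor 5 is 1 + 2 + 2. The isometry comes before the dual bound because it provides the norm
    constraint in [baddual]. *)
Lemma good_event : exists E : set T,
  [/\ measurable E, ((1 - 5 * n%:R `^ (- (1 / 10)))%:E <= P E)%E &
   forall w, E w ->
   [/\ forall x : 'cV[R]_n, (forall j, j \notin S -> x j 0 = 0) ->
         m%:R / 4 * norm2 x ^+ 2 <= norm2 (U w *m x) ^+ 2,
       forall j, `|coldot (U w) (U w *m certificate (U w) e (S :\ j)) j| <= 9 / 10 &
       forall i j, `|U w i j| <= ell]].
Proof.
have [m1 P1] := badnetP; have [m2 P2] := baddualP; have [m3 P3] := badmaxP.
set B1 := \bigcup_(_ in _) _ in m1 P1; set B2 := \bigcup_(_ in _) _ in m2 P2.
set B3 := \bigcup_(_ in _) _ in m3 P3.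
have mB : measurable (B1 `|` (B2 `|` B3)) by apply: measurableU => //; exact: measurableU.
exists (~` (B1 `|` (B2 `|` B3))); split.
- exact: measurableC.
- rewrite probability_setC//.
  have PB : (P (B1 `|` (B2 `|` B3)) <= (5 * n%:R `^ (- (1 / 10)))%:E)%E.
    have -> : 5 * n%:R `^ (- (1 / 10)) = expR (- ell / 10) +
        (2 * expR (- ell / 10) + 2 * expR (- ell / 10)) :> R.
      rewrite /powR gt_eqF// -/ell (_ : - (1 / 10) * ell = - ell / 10); ring.
    rewrite EFinD EFinD; apply: le_trans (leeD P1 (leeD P2 P3)).
    apply: (@le_trans _ _ (P B1 + P (B2 `|` B3))%E).
      by apply: measureU2 => //; exact: measurableU.
    by rewrite leeD2l// measureU2.
  by rewrite EFinB leeB.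
move=> w nB.
have AL i j : `|U w i j| <= ell.
  rewrite leNgt; apply/negP => h; apply: nB; right; right.
  exists (i, j); first by rewrite /= mem_enum.
  rewrite /badmax/= !big_seq1 mul1r expr1n; split => //.
  by move: h; rewrite mxE.
have isom (x : 'cV[R]_n) : (forall j, j \notin S -> x j 0 = 0) ->
         m%:R / 4 * norm2 x ^+ 2 <= norm2 (U w *m x) ^+ 2.
  apply: (isom_of_net (L := ell) (K := K)) => //.
  - by have := ell6; lra.
  - move=> k kn; rewrite leNgt; apply/negP => h; apply: nB; left.
    exists k; first by rewrite /= mem_enum.
    rewrite /badnet/=; move: h; under [in X in X -> _]eq_bigr do under eq_bigr do rewrite mxE.
    by [].
split => // j; rewrite leNgt; apply/negP => h; apply: nB; right; left.
have kap0 : 0 < m%:R / 4 :> R by rewrite divr_gt0.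
have sub : S :\ j \subset S by exact: finset.subsetDl.
have e1 l : `|e l 0| <= 1 by rewrite mxE normr_sg; case: eqP.
have wE i : (U w *m certificate (U w) e (S :\ j)) i 0 = wvec j w i.
  rewrite mxE (sum_split_set (S :\ j)) [X in _ + X]big1 ?addr0//.
  move=> l; rewrite finset.in_setC => lS.
  by rewrite (certificate_outside kap0 isom _ sub lS) mulr0.
exists j; first by rewrite /= mem_enum.
have sE (f : 'I_m * 'I_n -> R) :
    \sum_(k <- [seq (i, j) | i <- enum 'I_m]) f k = \sum_i f (i, j).
  by rewrite big_map big_enum.
rewrite /baddual; split; rewrite sE.
  suff <- : coldot (U w) (U w *m certificate (U w) e (S :\ j)) j =
      \sum_i wvec j w i * X (i, j) w by [].
  by apply: eq_bigr => i _; rewrite wE mxE mulrC.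
apply: le_trans (_ : #|S :\ j|%:R / (m%:R / 4) <= _).
  apply: le_trans (certificate_image_norm kap0 isom sub e1).
  by rewrite norm2_sqr; under [leRHS]eq_bigr do rewrite wE.
by rewrite ler_pM2r ?invr_gt0// ler_nat subset_leq_card.
Qed.

End GoodEvent.

(** * Support recovery *)

Section Bounds.
Context (R : realType).

Lemma ler_log2 (x y : R) : 1 <= y -> x <= y -> log2 x <= log2 y.
Proof.
move=> y1 xy; have y0 : 0 < y by lra.
rewrite /log2 ler_pM2r ?invr_gt0 ?ln_gt0//; last by lra.
have [x0|x0] := leP x 0; first by rewrite (ln0 x0) ln_ge0.
by rewrite ler_ln.
Qed.

Lemma log2Xn (x : R) k : 0 < x -> log2 (x ^+ k) = k%:R * log2 x.
Proof. by move=> x0; rewrite /log2 lnXn// -[ln x *+ k]mulr_natl mulrA. Qed.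

Lemma log2_ge1 (x : R) : 2 <= x -> 1 <= log2 x.
Proof.
by move=> x2; rewrite /log2 ler_pdivlMr ?ln_gt0 ?mul1r ?ler_ln ?posrE//; lra.
Qed.

(** 729 = 3^6, and e <= 3. *)
Lemma ln_ge6 (x : R) : 729 <= x -> 6 <= ln x.
Proof.
move=> x1; have x0 : 0 < x by lra.
rewrite -[leLHS]expRK ler_ln ?posrE ?expR_gt0//; apply: le_trans x1.
rewrite (_ : 6 = 1 * 6%:R) ?mul1r// -[X in expR X]mul1r expRM_natr.
apply: (@le_trans _ _ (3 ^+ 6)); last by lra.
by rewrite lerXn2r ?nnegrE ?expR_ge0// expR1_le3.
Qed.

(** As n - s >= 7n/8 >= n e^(-1/2), passing from ln (n - s) to ln n costs 12 s / 2 = 6 s, which is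
    at most s ln n: 12 drops to 11. *)
Lemma sample_size (m n s : nat) (eps : R) : 10 ^+ 5 <= n%:R :> R -> 0 < eps ->
  ln (n%:R / 2) <= s%:R :> R -> s%:R <= n%:R / 8 :> R ->
  (1 + eps) * 12 * s%:R * ln (n%:R - s%:R) < m%:R ->
  (0 < s)%N /\ 11 * s%:R * ln n%:R <= m%:R :> R.
Proof.
move=> nbig eps0 lns s8 ms.
have l6 : 6 <= ln n%:R :> R by apply: ln_ge6; lra.
have s0 : 0 < s%:R :> R by apply: lt_le_trans lns; rewrite ln_gt0//; lra.
split; first by rewrite -(ltr0n R).
have e78 : expR (- (1 / 2)) <= 7 / 8 :> R.
  rewrite expRN -[leLHS]mul1r ler_pdivrMr ?expR_gt0//.
  by have := expR_ge1Dx (1 / 2 : R); lra.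
have h : ln n%:R - 1 / 2 <= ln (n%:R - s%:R) :> R.
  apply: (@le_trans _ _ (ln (n%:R * expR (- (1 / 2))))).
    by rewrite lnM ?posrE ?expR_gt0// ?expRK//; lra.
  rewrite ler_ln ?posrE; last by lra.
    have : n%:R * expR (- (1 / 2)) <= n%:R * (7 / 8) :> R by rewrite ler_wpM2l//; lra.
    lra.
  by rewrite mulr_gt0 ?expR_gt0//; lra.
have : 12 * s%:R * ln (n%:R - s%:R) <= (1 + eps) * 12 * s%:R * ln (n%:R - s%:R).
  have -> : (1 + eps) * 12 * s%:R * ln (n%:R - s%:R) =
    (1 + eps) * (12 * s%:R * ln (n%:R - s%:R)) by ring.
  by rewrite ler_peMl ?mulr_ge0//; lra.
have : 12 * s%:R * (ln n%:R - 1 / 2) <= 12 * s%:R * ln (n%:R - s%:R) :> R.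
  by rewrite ler_wpM2l//; lra.
have : s%:R * 6 <= s%:R * ln n%:R :> R by rewrite ler_wpM2l//; lra.
lra.
Qed.

Lemma min_abs_le n (v : 'cV[R]_n) j : j \in supp v -> min_abs v <= `|v j 0|.
Proof.
move=> jS; apply: ge_inf; last by exists j.
by exists 0 => _ [i _ <-].
Qed.

Lemma normr_le_bnorm2 n (v : 'cV[R]_n) j : `|v j 0| <= bnorm2 v.
Proof.
apply: (@le_trans _ _ (norm2 v)); last by rewrite le_max lexx orbT.
rewrite -(ler_pXn2r (_ : (0 < 2)%N)) ?nnegrE ?sqrtr_ge0// norm2_sqr.
rewrite real_normK ?num_real// (bigD1 j)//= lerDl.
by apply: sumr_ge0 => i _; exact: sqr_ge0.
Qed.

Lemma bnorm2_ge1 n (v : 'cV[R]_n) : 1 <= bnorm2 v.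
Proof. by rewrite le_max lexx. Qed.

Lemma norm1_le n (v : 'cV[R]_n) (c : R) : (forall j, `|v j 0| <= c) ->
  norm1 v <= n%:R * c.
Proof.
move=> vc; rewrite /norm1 -[X in X%:R * _]card_ord mulr_natl -sumr_const.
by apply: ler_sum => j _; exact: vc.
Qed.

Section Polynomial.
Variables (m n : nat) (A : 'M[R]_(m, n)) (v : 'cV[R]_n).
Let N : R := n%:R.
Let V := bnorm2 v.
Hypothesis mn : (m <= n)%N.
Hypothesis N1 : 1 <= N.
Hypothesis AN : forall i j, `|A i j| <= N.

Let V1 : 1 <= V. Proof. exact: bnorm2_ge1. Qed.
Let mN : m%:R <= N. Proof. by rewrite ler_nat. Qed.

Lemma normr_mulmx_poly i : `|(A *m v) i 0| <= N ^+ 2 * V.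
Proof.
apply: le_trans (normr_mulmx_le v i AN) _.
rewrite expr2 -mulrA ler_wpM2l//; apply: norm1_le => j; exact: normr_le_bnorm2.
Qed.

Lemma bnorm_max_poly : bnorm_max (A *m v) A <= N ^+ 2 * V.
Proof.
have N2 : N <= N ^+ 2 by rewrite expr2 ler_peMl//; have := N1; lra.
have h : N <= N ^+ 2 * V.
  by apply: le_trans N2 _; rewrite ler_peMr// sqr_ge0.
rewrite /bnorm_max !ge_max; apply/andP; split; last by apply: le_trans h.
apply/andP; split; apply: mx_norm_ler.
- by have := N1; lra.
- by move=> i j; rewrite ord1; exact: normr_mulmx_poly.
- by have := N1; lra.
- by move=> i j; apply: le_trans (AN i j) h.
Qed.

Lemma bnorm_sum_poly : bnorm_sum (A *m v) A <= N ^+ 3 * V.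
Proof.
have N0 : 0 <= N by have := N1; lra.
have V0 : 0 <= V by have := V1; lra.
have h1 : 1 <= N ^+ 3 by rewrite exprn_ege1.
have h3 : N ^+ 3 <= N ^+ 3 * V by rewrite ler_peMr// exprn_ge0.
rewrite /bnorm_sum !ge_max; apply/andP; split; last exact: le_trans h3.
apply/andP; split.
  apply: le_trans h3; apply: (@le_trans _ _ (\sum_(i < m) N * N)).
    apply: ler_sum => i _; have -> : N * N = \sum_(j < n) N.
      by rewrite sumr_const card_ord /N -[RHS]mulr_natl.
    exact: ler_sum.
  rewrite sumr_const card_ord -[leLHS]mulr_natl !exprS expr0 mulr1.
  by rewrite ler_wpM2r// mulr_ge0.
apply: (@le_trans _ _ (m%:R * (N ^+ 2 * V))).
  by apply: norm1_le => i; exact: normr_mulmx_poly.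
by rewrite mulrA exprS ler_wpM2r// ler_wpM2r// sqr_ge0.
Qed.

End Polynomial.

(** For large N the numerical constant of the perturbation bound is absorbed by one more power of
    N. *)
Lemma cond_poly (c N V B : R) : 0 <= c -> 2 * c <= N -> 1 <= N -> 1 <= V ->
  B <= 1 + N * V -> c * N ^+ 7 * B <= N ^+ 9 * V.
Proof.
move=> c0 cN N1 V1 BV.
have NV1 : 1 <= N * V by rewrite -[leLHS]mulr1 ler_pM.
have B2 : B <= 2 * (N * V) by lra.
have N0 : 0 <= N by lra.
have V0 : 0 <= V by lra.
apply: (@le_trans _ _ (c * N ^+ 7 * (2 * (N * V)))).
  by apply: ler_wpM2l B2; rewrite mulr_ge0 ?exprn_ge0.
have -> : c * N ^+ 7 * (2 * (N * V)) = N ^+ 8 * V * (2 * c) by ring.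
have -> : N ^+ 9 * V = N ^+ 8 * V * N by ring.
by apply: ler_wpM2l cN; rewrite mulr_ge0 ?exprn_ge0.
Qed.

(** The upper bound on [lam] comes from hypothesis (ii), the one on its inverse from (iii). *)
Lemma lam_poly (lam M N V a : R) : 0 < lam -> 0 <= M -> M <= N -> 2 <= N ->
  1 <= V -> a <= V -> 16 * lam < 2 * M * a - 1 / N ^+ 2 -> 2 / N ^+ 2 <= lam ->
  lam + lam^-1 <= N ^+ 3 * V.
Proof.
move=> lam0 M0 MN N2 V1 aV up low.
have N0 : 0 < N by lra.
have NN : 0 < N ^+ 2 by rewrite exprn_gt0.
have lamV : lam <= N * V.
  have h1 : 0 <= 1 / N ^+ 2 by rewrite divr_ge0// ltW.
  have h2 : M * a <= M * V by exact: ler_wpM2l.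
  have h3 : M * V <= N * V by apply: ler_wpM2r => //; lra.
  have h4 : 0 <= N * V by rewrite mulr_ge0//; lra.
  have h5 : 2 * M * a = 2 * (M * a) by ring.
  lra.
have lamN : lam^-1 <= N ^+ 2.
  rewrite -[leLHS]mul1r ler_pdivrMr//; move: low; rewrite ler_pdivrMr//; lra.
have h1 : N ^+ 2 <= N ^+ 2 * V by rewrite ler_peMr// ltW.
have h2 : N * V <= N ^+ 2 * V.
  by apply: ler_wpM2r; [lra|rewrite expr2 ler_peMl//; lra].
have h3 : 2 * (N ^+ 2 * V) <= N ^+ 3 * V.
  have -> : N ^+ 3 * V = N * (N ^+ 2 * V) by ring.
  by apply: ler_wpM2r => //; rewrite mulr_ge0 ?ltW//; lra.
lra.
Qed.

End Bounds.

Theorem theorem2p5 (R : realType) :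
  exists cbar C1 C2 : R,
  [/\ 1 <= cbar, 0 < C1, 0 < C2 &
  forall K1 K2 : R, 0 < K1 -> 0 < K2 ->
  exists D1 D2 : R,
  [/\ 0 < D1, 0 < D2 &
  forall (lam : rat) (m N : nat) (G : program),
  0 < lam ->
  lasso_guarantees K1 K2 lam m N G ->
  forall v : 'cV[R]_N,
  let S := supp v in
  let s := #|S| in
  ln (N%:R / 2) <= s%:R :> R ->
  s%:R <= N%:R / 8 :> R ->
  m%:R <= N%:R / 9 :> R ->
  forall (d : measure_display) (T : measurableType d) (P : probability T R)
    (X : 'I_m * 'I_N -> {RV P >-> R}),
  iid_std_gaussian X ->
  let U := random_mx X in
  let b := fun w => U w *m v in
  forall eps : R,
  0 < eps -> eps < 1 / 2 ->
  8 * Num.sqrt (s%:R / m%:R) < eps ->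
  (1 + eps) * 12 * s%:R * ln (N%:R - s%:R) < m%:R ->
  cbar * ratr lam < 2 * m%:R * min_abs v - 1 / N%:R ^+ 2 ->
  2 / N%:R ^+ 2 <= ratr lam :> R ->
  exists E : set T,
  [/\ measurable E,
      ((1 - C1 * N%:R `^ (- C2))%:E <= P E)%E &
      forall w, E w ->
      forall o : oracle m N, approximates o (b w) (U w) ->
      exists c k : nat,
      [/\ computes o G lam S c k,
          c%:R <= D1 * (N%:R ^+ 3 * log2 (N%:R * bnorm2 v) ^+ 2) &
          k%:R <= D2 * (Num.ceil (log2 (N%:R * bnorm2 v)))%:~R]]]].
Proof.
(* With 16, hypothesis (ii) divided by 2m gives 8 lam / m < |v_j|, twice the largest shift of a
   coordinate. The rate 1/10 is that of [good_event]. *)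
exists 16, (10 ^+ 5), (1 / 10); split; [lra|exact: exprn_gt0|lra|].
(* The condition number is at most N^9 V with V = [bnorm2 v]. The logarithm in the cost has argument
   at most N^2 (N^2 V)^2 N^9 V <= (N V)^15, and 225 = 15^2; the one in the digits has argument at
   most (N V)^9. *)
move=> K1 K2 K10 K20; exists (225 * K1), (9 * K2); split; [lra|lra|].
move=> lam m n G lam0 HG v S s lns s8 m9 d T P X iidX U b eps eps0 _ _ ms cl lam2.
have n0 : (0 < n)%N.
  rewrite lt0n; apply/negP => /eqP n0.
  have m0 : m = 0%N by move: m9; rewrite n0 mul0r pmulrn lern0 => /eqP.
  have s0 : s = 0%N by move: s8; rewrite n0 mul0r lern0 => /eqP.
  by move: ms; rewrite m0 s0 mulr0 mul0r ltxx.
have nR : 0 < n%:R :> R by rewrite ltr0n.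
have n1 : 1 <= n%:R :> R by rewrite ler1n.
have [nbig|nsmall] := leP (10 ^+ 5) (n%:R : R); last first.
  (* Here n^(1/10) <= n < 10^5, so the claimed probability is not positive. *)
  exists set0; split => //; rewrite measure0 lee_fin subr_le0.
  rewrite powRN ler_pdivlMr ?powR_gt0// [leLHS]mul1r; apply: le_trans (ltW nsmall).
  have e1 : 1 / 10 <= 1 :> R by lra.
  by have := ler_powR n1 e1; rewrite powRr1 ?ler0n.
have [s0 msl] := sample_size nbig eps0 lns s8 ms.
have l6 : 6 <= ln n%:R :> R by apply: ln_ge6; lra.
have ln_n : ln n%:R + 1 <= n%:R :> R.
  by have := expR_ge1Dx (ln n%:R : R); rewrite lnK ?posrE//; lra.
have n2 : 2 <= n%:R :> R by apply: le_trans nbig; lra.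
have [c0 [cE c00 cn]] : exists c0 : R, [/\ c0 = 17 * 1000, 0 < c0 & 2 * c0 <= n%:R].
  exists (17 * 1000); split; [exact: erefl|by rewrite mulr_gt0 ?ltr0n|].
  by apply: le_trans nbig; lra.
clear nbig.
have [E [mE PE EP]] := good_event iidX s0 l6 msl m9.
exists E; split => //.
  apply: le_trans PE; rewrite lee_fin lerD2l lerN2 ler_wpM2r ?powR_ge0//; lra.
move=> w Ew o ob; have [isom dual Ul] := EP w Ew.
have mR : 0 < m%:R :> R.
  by apply: lt_le_trans msl; rewrite !mulr_gt0 ?ltr0n//; lra.
have m0 : (0 < m)%N by rewrite -(ltr0n R).
have mn : (m <= n)%N by rewrite -(ler_nat R); lra.
set V := bnorm2 v; have V1 : 1 <= V by exact: bnorm2_ge1.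
set N : R := n%:R in nR n1 cn n2 m9 lam2 cl s8 ms ln_n *.
have Un i j : `|U w i j| + 1 <= N by apply: le_trans ln_n; rewrite lerD2r.
have UN i j : `|U w i j| <= N by have := Un i j; lra.
have L0 : 0 < ratr lam :> R by rewrite ltr0q.
have vlarge j : j \in S -> 8 * ratr lam / m%:R < `|v j 0|.
  move=> jS; apply: lt_le_trans (min_abs_le jS); rewrite ltr_pdivrMr//.
  have : 0 <= 1 / N ^+ 2 by rewrite divr_ge0// exprn_ge0// ltW.
  by move: cl; lra.
pose B : R := 1 + norm1 v.
have norm1V : norm1 v <= N * V by apply: norm1_le => j; exact: normr_le_bnorm2.
have B1 : 1 <= B by rewrite lerDl sumr_ge0.
pose D := c0 * N ^+ 7 * B.
have D0 : 0 < D.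
  by rewrite mulr_gt0 ?mulr_gt0 ?exprn_gt0//; exact: lt_le_trans B1.
pose d0 := D^-1.
have d00 : 0 < d0 by rewrite invr_gt0.
have stab (y' : 'cV[R]_m) (A' : 'M[R]_(m, n)) (z : 'cV[R]_n) :
    (forall i, `|y' i 0 - (U w *m v) i 0| <= d0) ->
    (forall i j, `|A' i j - U w i j| <= d0) ->
    lasso_sol (ratr lam) y' A' z -> supp z = S.
  move=> yd Ad zs.
  apply: (lasso_supp_stable m0 mn s0 isom dual Un vlarge lam2 (ltW d00) _ yd Ad zs).
  by rewrite -cE mulVf ?gt_eqF.
clear cE.
have [Cfin Cle] := condUL_lty d00 stab.
have [+ _] := HG (b w) (U w) o ob => /(_ Cfin) [S' [c [k [comp suppS' cb kb]]]].
have S'E : S' = S by apply: lasso_supp_unique d00 stab _ suppS'.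
rewrite S'E in comp.
set C := fine _ in Cle cb kb.
have V0 : 0 <= V by exact: le_trans V1.
have N0 : 0 <= N by exact: ltW.
have C9 : C <= N ^+ 9 * V.
  apply: (le_trans Cle); rewrite /d0 invrK; apply: cond_poly => //; first exact: ltW.
  by rewrite /B lerD2l.
clear Cle.
pose Q := N * V.
have QN : N <= Q by rewrite ler_peMr.
have Q1 : 1 <= Q by exact: le_trans QN.
have Q0 : 0 < Q by exact: lt_le_trans Q1.
have lQ : 1 <= log2 Q by apply: log2_ge1; exact: le_trans n2 QN.
have lQ0 : 0 <= log2 Q by exact: le_trans lQ.
have NVQ p q : (q <= p)%N -> N ^+ p * V ^+ q <= Q ^+ p.
  move=> qp; rewrite /Q exprMn; apply: ler_wpM2l; first by rewrite exprn_ge0.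
  exact: ler_weXn2l V1 _ _ qp.
exists c, k; split => //.
  apply: (le_trans cb).
  have -> : 225 * K1 * (N ^+ 3 * log2 Q ^+ 2) = K1 * (N ^+ 3 * (15%:R * log2 Q) ^+ 2).
    by ring.
  apply: ler_wpM2l; first exact: ltW.
  apply: ler_wpM2l; first exact: exprn_ge0.
  have t0 : 0 <= 15%:R * log2 Q by apply: mulr_ge0.
  suff : Num.max 1 (log2 (N ^+ 2 * bnorm_max (b w) (U w) ^+ 2 * C)) <= 15%:R * log2 Q.
    by move=> h; rewrite lerXn2r ?nnegrE// le_max ler01.
  rewrite ge_max; apply/andP; split.
    by apply: (le_trans lQ); rewrite ler_peMl// ler1n.
  rewrite -log2Xn//; apply: ler_log2; first by rewrite exprn_ege1.
  apply: (le_trans _ (NVQ 15%N 3%N isT)).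
  have bm : bnorm_max (b w) (U w) <= N ^+ 2 * V by exact: bnorm_max_poly.
  have bm0 : 0 <= bnorm_max (b w) (U w) by rewrite /bnorm_max le_max ler01 orbT.
  have -> : N ^+ 15 * V ^+ 3 = N ^+ 2 * (N ^+ 2 * V) ^+ 2 * (N ^+ 9 * V) by ring.
  apply: (@le_trans _ _ (N ^+ 2 * bnorm_max (b w) (U w) ^+ 2 * (N ^+ 9 * V))).
    by apply: ler_wpM2l C9; rewrite mulr_ge0 ?exprn_ge0.
  apply: ler_wpM2r; first by rewrite mulr_ge0 ?exprn_ge0.
  apply: ler_wpM2l; first by rewrite exprn_ge0.
  by rewrite lerXn2r ?nnegrE// mulr_ge0 ?exprn_ge0.
apply: (le_trans kb).
have -> : 9 * K2 * (Num.ceil (log2 Q))%:~R = K2 * (9 * (Num.ceil (log2 Q))%:~R) by ring.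
apply: ler_wpM2l; first exact: ltW.
have -> : 9 * (Num.ceil (log2 Q))%:~R = (9 * Num.ceil (log2 Q))%:~R :> R by rewrite intrM.
rewrite ler_int ceil_le_int intrM.
apply: (@le_trans _ _ (9%:R * log2 Q)); last by apply: ler_wpM2l => //; exact: ceil_ge.
rewrite -log2Xn//; apply: ler_log2; first by rewrite exprn_ege1.
have h9 : N ^+ 9 * V <= Q ^+ 9 by have := NVQ 9%N 1%N isT; rewrite expr1.
have h3 : N ^+ 3 * V <= N ^+ 9 * V.
  by apply: ler_wpM2r => //; exact: (ler_weXn2l n1).
have h39 := le_trans h3 h9.
rewrite 3!ge_max -!andbA; apply/and4P; split.
- apply: (le_trans _ h39); apply: (@lam_poly _ _ m%:R _ _ (min_abs v)) => //.
  + by rewrite /N ler_nat.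
  + have [j jS] : exists j, j \in S by apply/card_gt0P.
    exact: le_trans (min_abs_le jS) (normr_le_bnorm2 _ _).
- by apply: (le_trans QN); rewrite -[leLHS]expr1; exact: (ler_weXn2l Q1).
- by apply: (le_trans _ h39); exact: bnorm_sum_poly.
- exact: le_trans h9.
Qed.
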